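(* Let $k\ge1$, let $\alpha_{n_1n_2\dots n_k}$ ($0\le n_i\le3$, $n_k\neq0$) be a periodic direction, and let $w$ be its short (respectively, long) symbolic orbit. For $j=1,2,3,4$ let $w_j$ be the cyclic word obtained from $w$ by first replacing each symbol $s\in\{1,2,3,4,5\}$ of $w$ by $s+j$ (taken modulo 5 in $\{1,\dots,5\}$), and then, between every two cyclically consecutive symbols $p,q$ of the resulting word, inserting in order all the intermediate vertices passed when travelling from $p$ to $q$ along the path graph $$1 - 4 - 3 - 2 - 5 .$$ Then, for $j=1,2,3,4$, the cyclic word $w_j$ is the short (respectively, long) symbolic orbit corresponding to the periodic direction $$\alpha_{j-1,\,3-n_1,\,3-n_2,\dots,3-n_{k-1},\,4-n_k}.$$
   Context: Let $\phi=\frac{1+\sqrt5}{2}$. Let $P$ be a regular plane pentagon of side $1$ with a horizontal side at the bottom; label its sides, counterclockwise starting from the bottom side, by $3,5,2,4,1$. Let $P'=-P$ be its centrally symmetric copy; the side of $P'$ parallel to side $i$ of $P$ is also labelled $i$. The double pentagon $X$ is the flat surface obtained from $P\sqcup P'$ by gluing, for each $i$, the two sides labelled $i$ by a parallel translation. Directions of linear trajectories on $X$ are considered modulo $180^\circ$. The direction making angle $\theta$ (counterclockwise) with the horizontal is identified with the point $x=-\sin 36^\circ\cot\theta\in\mathbb{R}\cup\{\infty\}$. The 3rd sector is $72^\circ\le\theta\le108^\circ$, i.e. $\frac{\phi}{2}-1\le x\le 1-\frac{\phi}{2}$. Regard $\mathbb{R}\cup\{\infty\}$ as the boundary at infinity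 of the hyperbolic plane. The ideal pentagon of generation $0$ has vertices $1-\frac{\phi}{2},\frac{\phi}{2},\infty,-\frac{\phi}{2},\frac{\phi}{2}-1$ (in cyclic order). The pentagons of generation $k+1$ are obtained from those of generation $k$ by reflecting each of them in its sides (for $k\ge1$, in its four sides not shared with a pentagon of generation $k-1$). The vertices in the 3rd sector are labelled recursively: put $\alpha=1-\frac{\phi}{2}$ and let $I_\emptyset$ be the arc from $\alpha$ down to $\frac{\phi}{2}-1$. Given an arc $I_{n_1\dots n_k}$ whose endpoints span a side of a pentagon of generation $k$, the pentagon of generation $k+1$ across this side has vertices $v_0>v_1>v_2>v_3>v_4$ with $v_0,v_4$ the endpoints of the arc; set $\alpha_{n_1\dots n_k m}=v_m$ and let $I_{n_1\dots n_k m}$ be the arc from $v_m$ to $v_{m+1}$, $0\le m\le3$ (so $\alpha_{n_1\dots n_k0}=\alpha_{n_1\dots n_k}$, and trailing zeros are dropped). These points are periodic directions: for such a direction $X$ decomposes into two strips of parallel closed trajectories. The symbolic orbit of a closed trajectory is the word in $1,\dots,5$ formed by the labels of the sides consecutively crossed in one traversal, considered up to cyclic permutation; it is the same for all trajectories of one strip. The short (long) symbolic orbit of a periodic direction is that of the strip whose trajectories have the smaller (larger) length. *)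

(* Defs.v *)
From mathcomp Require Import all_boot all_order all_algebra.
From mathcomp Require Import all_classical all_reals all_analysis.

Set Implicit Arguments.
Unset Strict Implicit.
Unset Printing Implicit Defensive.

Import Order.TTheory GRing.Theory Num.Theory.

Local Open Scope ring_scope.

Definition phi (R : realType) : R := (1 + Num.sqrt 5) / 2.

(* R^o makes the plane a module over R, so that t *: p is available. *)
Definition plane (R : realType) : Type := (R^o * R^o)%type.

Definition unit_vec (R : realType) (theta : R) : plane R :=
  (cos theta, sin theta).

Definition cross (R : realType) (u v : plane R) : R := u.1 * v.2 - u.2 * v.1.

(* P has vertices pent_vertex 0, ..., pent_vertex 4 in counterclockwise order,
   starting at the origin with the horizontal bottom side; each side is a unit
   vector and turns by 72 degrees with respect to the preceding one. *)
Definition pent_vertex (R : realType) (i : nat) : plane R :=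
  \sum_(k < i) unit_vec (k%:R * (2 * pi / 5)).

Definition side_labels : seq nat := [:: 3; 5; 2; 4; 1]%N.

Definition side_src (R : realType) (l : nat) : plane R :=
  pent_vertex R (index l side_labels).

Definition side_dst (R : realType) (l : nat) : plane R :=
  pent_vertex R (index l side_labels).+1.

(* The pentagon P is encoded by false and P' = -P by true. *)
Definition pent_sign (R : realType) (b : bool) : R := (-1) ^+ b.

(* Side l without its end points. *)
Definition on_side (R : realType) (b : bool) (l : nat) (p : plane R) : Prop :=
  l \in side_labels /\
  exists t : R, [/\ 0 < t, t < 1 &
    p = pent_sign R b *: ((1 - t) *: side_src R l + t *: side_dst R l)].

(* The translation gluing side l of the pentagon b to side l of the other one:
   if side l of P is [A, B], then side l of P' is [-B, -A], and the translation
   from the former to the latter has vector - (A + B). *)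
Definition glue (R : realType) (b : bool) (l : nat) (p : plane R) : plane R :=
  p - pent_sign R b *: (side_src R l + side_dst R l).

(* One piece of a trajectory: it starts at the point start of side entry of the
   pentagon pent, and crosses this pentagon along a segment of length len. *)
Record chord (R : realType) := Chord {
  pent : bool;
  entry : nat;
  start : plane R;
  len : R
}.

Definition chord_end (R : realType) (theta : R) (c : chord R) : plane R :=
  start c + len c *: unit_vec theta.

(* A trajectory in direction theta which never meets a vertex. By convexity, a
   segment joining interior points of two different sides of a pentagon runs
   inside it. *)
Definition trajectory (R : realType) (theta : R) (c : nat -> chord R) : Prop :=
  forall k, [/\ on_side (pent (c k)) (entry (c k)) (start (c k)),
                0 < len (c k),
                entry (c k) != entry (c k.+1),
                on_side (pent (c k)) (entry (c k.+1)) (chord_end theta (c k)) &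
                pent (c k.+1) = ~~ pent (c k) /\
                start (c k.+1) =
                  glue (pent (c k)) (entry (c k.+1)) (chord_end theta (c k))].

(* n is the number of sides crossed in one traversal. *)
Definition closed_trajectory (R : realType) (theta : R) (c : nat -> chord R)
    (n : nat) : Prop :=
  [/\ trajectory theta c,
      (0 < n)%N,
      forall k, c (k + n)%N = c k &
      forall m, (0 < m < n)%N -> c m <> c 0%N].

Definition orbit_word (R : realType) (c : nat -> chord R) (n : nat) : seq nat :=
  mkseq (fun k => entry (c k)) n.

Definition orbit_length (R : realType) (c : nat -> chord R) (n : nat) : R :=
  \sum_(k < n) len (c k).

(* Up to the choice of its starting point, c' is the parallel displacement of c
   by a distance |h|, and crosses the same sides: the band between them contains
   no vertex. For a closed trajectory c, the c' related to it in this way are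
   those of the (maximal) strip of closed trajectories containing c. *)
Definition same_strip (R : realType) (theta : R) (c c' : nat -> chord R) :
    Prop :=
  exists (m : nat) (h : R), forall k,
    [/\ pent (c' k) = pent (c (m + k)%N),
        entry (c' k) = entry (c (m + k)%N) &
        cross (unit_vec theta) (start (c' k) - start (c (m + k)%N)) = h].

(* The surface decomposes into exactly two strips of closed trajectories in
   direction theta, those of c1 and of c2. *)
Definition two_strips (R : realType) (theta : R)
    (c1 : nat -> chord R) (n1 : nat) (c2 : nat -> chord R) (n2 : nat) : Prop :=
  [/\ closed_trajectory theta c1 n1,
      closed_trajectory theta c2 n2,
      ~ same_strip theta c1 c2 &
      forall c, trajectory theta c ->
        same_strip theta c1 c \/ same_strip theta c2 c].

Definition cyclic_eq (w w' : seq nat) : Prop := exists i : nat, w' = rot i w.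

(* Both theta and theta + pi satisfy this: directions are modulo 180 degrees. *)
Definition has_direction (R : realType) (theta x : R) : Prop :=
  sin theta != 0 /\ x = - sin (pi / 5) * (cos theta / sin theta).

Definition short_orbit (R : realType) (x : R) (w : seq nat) : Prop :=
  exists theta c1 n1 c2 n2,
    [/\ has_direction theta x,
        two_strips theta c1 n1 c2 n2,
        orbit_length c1 n1 < orbit_length c2 n2 &
        cyclic_eq (orbit_word c1 n1) w].

Definition long_orbit (R : realType) (x : R) (w : seq nat) : Prop :=
  exists theta c1 n1 c2 n2,
    [/\ has_direction theta x,
        two_strips theta c1 n1 c2 n2,
        orbit_length c1 n1 > orbit_length c2 n2 &
        cyclic_eq (orbit_word c1 n1) w].

(* Ideal points are elements of option R, with None the point at infinity. The
   reflection in the hyperbolic line with end points a, b acts on them as the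
   inversion in the circle with diameter [a, b]. *)
Definition reflect_ideal (R : realType) (a b : R) (x : option R) : option R :=
  let o := (a + b) / 2 in
  let r := (a - b) / 2 in
  match x with
  | None => Some o
  | Some x => if x == o then None else Some (o + r ^+ 2 / (x - o))
  end.

Definition pentagon0 (R : realType) : seq (option R) :=
  [:: Some (1 - phi R / 2); Some (phi R / 2); None;
      Some (- (phi R / 2)); Some (phi R / 2 - 1)].

(* The vertices v_0 > ... > v_4 of the reflection of the pentagon V in its side
   with end points a, b (they are all finite for the sides lying under the arc
   from 1 - phi / 2 to phi / 2 - 1, this arc included). *)
Definition pentagon_across (R : realType) (V : seq (option R)) (a b : R) :
    seq R :=
  sort >=%R (pmap (reflect_ideal a b) V).

(* From a pentagon of generation k and the end points of I_{n_1 ... n_k}, to the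
   pentagon of generation k + 1 and the end points of I_{n_1 ... n_k m}. *)
Definition descend (R : realType) (VI : seq (option R) * (R * R)) (m : nat) :
    seq (option R) * (R * R) :=
  let v := pentagon_across VI.1 VI.2.1 VI.2.2 in
  (map Some v, (v`_m, v`_m.+1)).

Definition arc (R : realType) (s : seq nat) : R * R :=
  (foldl (@descend R) (pentagon0 R, (1 - phi R / 2, phi R / 2 - 1)) s).2.

(* alpha_{n_1 ... n_k m} = v_m is the upper end point of I_{n_1 ... n_k m}. *)
Definition alpha (R : realType) (s : seq nat) : R := (arc R s).1.

Definition path_graph : seq nat := [:: 1; 4; 3; 2; 5]%N.

(* The vertices strictly between p and q, from p to q. *)
Definition path_between (p q : nat) : seq nat :=
  let i := index p path_graph in
  let j := index q path_graph in
  if (i < j)%N then take (j - i.+1) (drop i.+1 path_graph)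
  else rev (take (i - j.+1) (drop j.+1 path_graph)).

Definition shift_label (j s : nat) : nat := ((s + j).-1 %% 5).+1.

Definition fill_path (v : seq nat) : seq nat :=
  flatten [seq pq.1 :: path_between pq.1 pq.2 | pq <- zip v (rot 1 v)].

Definition transform_word (j : nat) (w : seq nat) : seq nat :=
  fill_path (map (shift_label j) w).

(* Main.v *)
Require Import Defs.
From mathcomp Require Import all_boot all_order all_algebra.
From mathcomp Require Import all_classical all_reals all_analysis.
From mathcomp Require Import zify ring lra.
Set Implicit Arguments.
Unset Strict Implicit.
Unset Printing Implicit Defensive.
Import Order.TTheory GRing.Theory Num.Theory.
Local Open Scope ring_scope.

(** Write a direction of the open 3rd sector as u = a e + b e', where e and e'
    are the unit vectors at 72 and 108 degrees and a, b > 0. In the basis (e, e')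
    the vertices of P have coordinates in Z[phi] ([pent_vertexE]), and no
    trigonometry is left.

    Coding. A trajectory in direction u crosses the sides 1, 3, 5 into one of
    the two pentagons and 2, 4 into the other, so each crossing is given by a
    label s and a real z, twice its signed transverse distance to the midpoint of
    side s, with |z| < [width a b s]. The label s is always followed by a neighbour
    of s in the path graph 1 - 4 - 3 - 2 - 5, and z then grows by a constant
    [drift a b] of that edge. Hence trajectories are exactly the orbits of the
    map [flow a b] which never meet an end of a side ([regular_trajectory],
    [trajectory_regular]), and strips, closed trajectories, words and lengths
    are read off these orbits.

    Renormalization. Adding j to the labels amounts to a rotation of X, which
    moves u out of the 3rd sector; X also has an affine automorphism whose
    derivative fixes e and negates e', and which brings the direction back to
    that sector, at u' = a' e + b' e'. The composite maps side s onto side s + j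
    itself if s + j is 1 or 5, and otherwise onto the second diagonal of the
    parallelogram which has side s + j as a diagonal and its sides parallel to e
    and e'. A line in direction u' which crosses the second diagonal also
    crosses the side, so the crossing (s, z) becomes the crossing
    (s + j, - z) ([renorm]; the sign is that of the determinant). The remaining
    crossings of the image trajectory are forced by the path graph, and
    [refine_step] says that they fill the path from s + j to the next such
    label: this is the insertion of letters. A crossing of the image trajectory
    is an inserted one if and only if its two neighbours have different labels
    ([kept_turn]), so the insertion can be undone on every trajectory in
    direction u'. It follows that the two strips in direction u give the two
    strips in direction u' ([refine_two_bands]). The displacement along a closed
    trajectory is a multiple of u, and the composite acts on it
    linearly; so both lengths are multiplied by the same factor
    ([travel_refine]), and the shorter strip goes to the shorter one.

    Labels of directions. If p and q are suitable vectors for the end points of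
    an arc, those of the pentagon across it are p, phi p + q, phi (p + q),
    p + phi q, q ([pentagon_acrossE]). This rule is linear and symmetric under
    the exchange of p and q. The renormalization (a, b) -> (a', b') is linear
    and maps the 3rd sector to the arc j - 1 with its end points exchanged,
    whence the digits j - 1, 3 - n_1, ..., 4 - n_k ([alpha_directionP]). *)

(** * The golden ratio *)

Lemma phi_sqr (R : realType) : phi R * phi R = phi R + 1.
Proof.
have h : Num.sqrt (5 : R) * Num.sqrt 5 = 5 by rewrite -expr2 sqr_sqrtr //; lra.
rewrite /phi; lra.
Qed.

Lemma phi_gt1 (R : realType) : 1 < phi R.
Proof.
have h : (1 : R) < Num.sqrt 5 by rewrite -[ltLHS]sqrtr1 ltr_sqrt; lra.
rewrite /phi; lra.
Qed.

Lemma phi_lt2 (R : realType) : phi R < 2.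
Proof. have := phi_sqr R; have := phi_gt1 R; nra. Qed.

Lemma phi_sqrM (R : realType) (a : R) : phi R * phi R * a = phi R * a + a.
Proof. by rewrite phi_sqr; ring. Qed.

Lemma ltr_phiM (R : realType) (a : R) : 0 < a -> a < phi R * a.
Proof. by move=> a0; rewrite ltr_pMl ?phi_gt1. Qed.

Lemma one_to_four (j : nat) : (1 <= j <= 4)%N ->
  j = 1%N \/ j = 2%N \/ j = 3%N \/ j = 4%N.
Proof. by lia. Qed.

(* Only closed terms on labels are evaluated: the reals have to stay folded. *)
Ltac eval_labels := repeat match goal with
  | |- context [path_between (shift_label ?j ?s) (shift_label ?j ?t)] =>
     let v := eval cbv in (path_between (shift_label j s) (shift_label j t)) in
     change (path_between (shift_label j s) (shift_label j t)) with v
  | |- context [shift_label ?j ?s] =>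
     let v := eval cbv in (shift_label j s) in
     change (shift_label j s) with v
  end.

(** * The coding as an interval exchange *)

(** A crossing of a side: its label, and twice the transverse coordinate of the
    crossing point relative to the midpoint of the side. *)
Definition state (R : realType) := (nat * R)%type.

Section Dynamics.
Variable R : realType.
Local Notation f := (phi R).
Local Notation state := (state R).

(** The length of side s seen in the direction (a, b): up to sign, the determinant
    of (a, b) and of the side in the basis (e, e'). In the order 1, 2, 3, 4, 5 the
    same five linear forms also give the vertices of a pentagon of the
    tessellation, see [vertex]. *)
Definition width (a b : R) (s : nat) : R :=
  match s with
  | 1%N => a | 2%N => f * a + b | 3%N => f * (a + b) | 4%N => a + f * b
  | _ => b
  end.

(** Twice the vector from the midpoint of side s to that of side t, through the
    pentagon which a trajectory of the 3rd sector crosses from s to t; the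
    orientation is chosen so that the coordinates are nonnegative. *)
Definition holonomy (s t : nat) : R * R :=
  match s, t with
  | 1%N, 4%N | 4%N, 1%N => (f, 0)
  | 4%N, 3%N | 3%N, 4%N => (0, f + 1)
  | 3%N, 2%N | 2%N, 3%N => (f + 1, 0)
  | 2%N, 5%N | 5%N, 2%N => (0, f)
  | _, _ => (0, 0)
  end.

Definition drift (a b : R) (s t : nat) : R :=
  a * (holonomy s t).2 - b * (holonomy s t).1.

(** A threshold separates the crossing points from which the trajectory leaves
    through either of two sides; a point equal to its threshold leads to a vertex,
    and is sent to a state which is not [valid]. *)
Definition next_side (a b : R) (x : state) : nat :=
  match x.1 with
  | 1%N => 4%N
  | 2%N => if x.2 < b - f * a then 5%N else 3%N
  | 3%N => if x.2 < f * (b - a) then 4%N else 2%N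
  | 4%N => if f * b - a < x.2 then 1%N else 3%N
  | _ => 2%N
  end.

Definition flow (a b : R) (x : state) : state :=
  (next_side a b x, x.2 + drift a b x.1 (next_side a b x)).

Definition valid (a b : R) (x : state) : bool :=
  (x.1 \in side_labels) && (`|x.2| < width a b x.1).

Definition regular (a b : R) (x : state) : Prop :=
  forall k, valid a b (iter k (flow a b) x).

Definition adjacent (s t : nat) : bool :=
  (s, t) \in [:: (1, 4); (4, 1); (4, 3); (3, 4); (3, 2); (2, 3); (2, 5); (5, 2)]%N.

(** The relation is what can be checked by linear arithmetic on both ends of a
    chord; by [step_flow] and [flow_of_step] it is the graph of [flow] on the
    valid states whose image is valid. *)
Definition step (a b : R) (x y : state) : bool :=
  [&& valid a b x, valid a b y, adjacent x.1 y.1 &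
      y.2 == x.2 + drift a b x.1 y.1].

Lemma next_side_adjacent (a b : R) (x : state) :
  x.1 \in side_labels -> adjacent x.1 (next_side a b x).
Proof.
case: x => s z; rewrite /= /next_side /= !inE.
by move=> /or4P[/eqP->|/eqP->|/eqP->|/orP[/eqP->|/eqP->]] //=; case: ifP.
Qed.

Lemma step_flow (a b : R) (x : state) :
  valid a b x -> valid a b (flow a b x) -> step a b x (flow a b x).
Proof.
move=> vx vy; rewrite /step vx vy /= eqxx andbT.
by apply: next_side_adjacent; case/andP: vx.
Qed.

Variant adjacent_spec : nat -> nat -> Prop :=
| Adjacent14 : adjacent_spec 1 4 | Adjacent41 : adjacent_spec 4 1
| Adjacent43 : adjacent_spec 4 3 | Adjacent34 : adjacent_spec 3 4
| Adjacent32 : adjacent_spec 3 2 | Adjacent23 : adjacent_spec 2 3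
| Adjacent25 : adjacent_spec 2 5 | Adjacent52 : adjacent_spec 5 2.

Lemma adjacentP (s t : nat) : adjacent s t -> adjacent_spec s t.
Proof.
rewrite /adjacent !inE !xpair_eqE.
by do 7?[case/orP]; case/andP=> /eqP-> /eqP->; constructor.
Qed.

Variant step_spec (a b : R) (x y : state) : Prop :=
  StepSpec s t z of x = (s, z) & y = (t, z + drift a b s t) &
    adjacent_spec s t & - width a b s < z < width a b s &
    - width a b t < z + drift a b s t < width a b t.

Lemma stepP (a b : R) (x y : state) : step a b x y -> step_spec a b x y.
Proof.
case: x y => s z [t z'] /and4P[/andP[_ +] /andP[_ +] /= /adjacentP + /eqP].
rewrite !ltr_norml /= => hx hy hst hz; rewrite hz in hy *.
exact: (StepSpec erefl erefl).
Qed.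

Definition neighbours (s : nat) : seq nat :=
  match s with
  | 1%N => [:: 4%N] | 4%N => [:: 1%N; 3%N] | 3%N => [:: 4%N; 2%N]
  | 2%N => [:: 3%N; 5%N] | _ => [:: 2%N]
  end.

Lemma step_from (a b : R) (s : nat) (z : R) (y : state) :
  step a b (s, z) y ->
  has (fun t => (y == (t, z + drift a b s t)) &&
    (- width a b t < z + drift a b s t < width a b t)) (neighbours s).
Proof.
case/stepP=> s' t z' [-> ->] -> [] _ /= ->;
by rewrite !xpair_eqE /= !eqxx ?orbT.
Qed.

Lemma flow_of_step (a b : R) (x y : state) : step a b x y -> flow a b x = y.
Proof.
have ffa := phi_sqrM a; have ffb := phi_sqrM b.
case/stepP=> s t z -> -> [] /=; rewrite /drift /= => hx hy;
 rewrite /flow /next_side /drift //=.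
all: by case: ltP => h //; exfalso; lra.
Qed.

(** * Renormalization of one step *)

(** The affine automorphism has determinant -1: it reverses the transverse
    coordinate. *)
Definition renorm (j : nat) (x : state) : state := (shift_label j x.1, - x.2).
Definition unrenorm (j : nat) (x : state) : state := (shift_label (5 - j) x.1, - x.2).

(** Sides 1 and 5 are preserved by the affine automorphism and have widths a' and b'
    in the new direction (a', b'); these are the widths of the sides 1 - j and
    5 - j in the old one. *)
Definition renorm_fst (j : nat) (a b : R) := width a b (shift_label (5 - j) 1).
Definition renorm_snd (j : nat) (a b : R) := width a b (shift_label (5 - j) 5).

Definition inserted (j : nat) (a b : R) (x y : state) : seq state :=
  scanl (fun u t => (t, u.2 + drift (renorm_fst j a b) (renorm_snd j a b) u.1 t))
    (renorm j x) (path_between (shift_label j x.1) (shift_label j y.1)).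

(** One chord from side s to side t becomes a chain of chords along the path from
    s + j to t + j. The inserted crossings miss the image of the sides: that is
    the second part, as the image of side s is cut out of side s + j by the old
    width. All this is a finite list of inequalities between a, b, phi a and
    phi b. *)
Lemma refine_step (j : nat) (a b : R) (x y : state) : 0 < a -> 0 < b ->
  (1 <= j <= 4)%N -> step a b x y ->
  path (step (renorm_fst j a b) (renorm_snd j a b)) (renorm j x)
    (rcons (inserted j a b x y) (renorm j y)) &&
  all (fun u => ~~ valid a b (unrenorm j u)) (inserted j a b x y).
Proof.
move=> a0 b0 hj.
have fa := ltr_phiM a0; have fb := ltr_phiM b0.
have ffa := phi_sqrM a; have ffb := phi_sqrM b.
have {}hj := one_to_four hj.
case/stepP=> s t z -> -> [] /=; rewrite /drift /= => hx hy.
all: case: hj => [->|[->|[->|->]]].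
all: rewrite /inserted /renorm_fst /renorm_snd /renorm /unrenorm /step /valid /adjacent /drift /=.
all: by rewrite -?leNgt !ltr_norml ?ler_normr ?eqxx /=; lra.
Qed.

Lemma renormK (j : nat) (x : state) : (1 <= j <= 4)%N -> x.1 \in side_labels ->
  unrenorm j (renorm j x) = x.
Proof.
case: x => s z /= hj hs; rewrite /unrenorm /renorm /= opprK; congr (_, _).
have {}hj := one_to_four hj.
move: hs; rewrite !inE.
case/or4P=> [/eqP->|/eqP->|/eqP->|/orP[/eqP->|/eqP->]];
by case: hj => [->|[->|[->|->]]].
Qed.

Lemma unrenormK (j : nat) (y : state) : (1 <= j <= 4)%N -> y.1 \in side_labels ->
  renorm j (unrenorm j y) = y.
Proof.
case: y => s z /= hj hs; rewrite /unrenorm /renorm /= opprK; congr (_, _).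
have {}hj := one_to_four hj.
move: hs; rewrite !inE.
case/or4P=> [/eqP->|/eqP->|/eqP->|/orP[/eqP->|/eqP->]];
by case: hj => [->|[->|[->|->]]].
Qed.

(** A crossing of the new trajectory comes from the old one exactly when its letter
    is sandwiched, i.e. when the walk on the path graph turns back there. *)
Lemma kept_turn (j : nat) (a b : R) (y0 y1 y2 : state) : 0 < a -> 0 < b ->
  (1 <= j <= 4)%N ->
  step (renorm_fst j a b) (renorm_snd j a b) y0 y1 ->
  step (renorm_fst j a b) (renorm_snd j a b) y1 y2 ->
  valid a b (unrenorm j y1) = (y0.1 == y2.1).
Proof.
move=> a0 b0 hj.
have fa := ltr_phiM a0; have fb := ltr_phiM b0.
have ffa := phi_sqrM a; have ffb := phi_sqrM b.
have {}hj := one_to_four hj.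
case/stepP=> s t z -> -> h1 hz ht; case/stepP=> t' u z' [<- <-] {t' z'} -> h2 _ hu.
case: h1 h2 hz ht hu => h2; inversion_clear h2; case: hj => [->|[->|[->|->]]];
 rewrite /renorm_fst /renorm_snd /unrenorm /valid /drift /= => hz ht hu.
all: rewrite ltr_norml; match goal with
  | |- _ = (?m == ?m)%N => rewrite eqxx; lra
  | |- _ => apply/negbTE; rewrite negb_and -!leNgt; lra
  end.
Qed.

Lemma regular_step (a b : R) (x : state) (k : nat) : regular a b x ->
  step a b (iter k (flow a b) x) (iter k.+1 (flow a b) x).
Proof. by move=> rx; apply: step_flow; [exact: (rx k)|exact: (rx k.+1)]. Qed.

Lemma regular_iter (a b : R) (x : state) (m : nat) :
  regular a b x -> regular a b (iter m (flow a b) x).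
Proof. by move=> rx k; rewrite -iterD; apply: rx. Qed.

(** The central symmetry of X preserves every side, its midpoint and its label, and
    it reverses the order of the crossings. *)
Lemma step_rev (a b : R) (x y : state) : step a b x y ->
  step a b (y.1, - y.2) (x.1, - x.2).
Proof.
case/stepP=> s t z -> -> h hz hz'; rewrite /step /valid /= !normrN !ltr_norml.
rewrite hz hz' /=; case: h hz hz' => /= _ _.
all: by apply/eqP; rewrite /drift /=; ring.
Qed.

Lemma step_inj (a b : R) (x x' y : state) :
  step a b x y -> step a b x' y -> x = x'.
Proof.
move=> /step_rev/flow_of_step h /step_rev/flow_of_step; rewrite h.
by case: x x' {h} => s z [s' z'] /= [-> /oppr_inj ->].
Qed.

(** The path graph has five vertices: a walk cannot move on for five steps. *)
Lemma walk_turns (s : nat -> nat) : (forall k, adjacent (s k) (s k.+1)) ->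
  exists k, s k = s k.+2.
Proof.
move=> h; move: (adjacentP (h 0%N)) (adjacentP (h 1%N)) (adjacentP (h 2%N))
  (adjacentP (h 3%N)) (adjacentP (h 4%N)).
move=> h0 h1 h2 h3 h4.
have [?|e0] := eqVneq (s 0%N) (s 2%N); first by exists 0%N.
have [?|e1] := eqVneq (s 1%N) (s 3%N); first by exists 1%N.
have [?|e2] := eqVneq (s 2%N) (s 4%N); first by exists 2%N.
have [?|e3] := eqVneq (s 3%N) (s 5%N); first by exists 3%N.
exfalso; move: e0 e1 e2 e3.
by inversion h0; inversion h1; try congruence; inversion h2; try congruence;
 inversion h3; try congruence; inversion h4; try congruence.
Qed.

(** If the old trajectory runs into a vertex, so does the new one, within four
    crossings. *)
Lemma singular_refined (j : nat) (a b : R) (x : state) : 0 < a -> 0 < b ->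
  (1 <= j <= 4)%N -> valid a b x ->
  regular (renorm_fst j a b) (renorm_snd j a b) (renorm j x) -> valid a b (flow a b x).
Proof.
move=> a0 b0 hj.
have fa := ltr_phiM a0; have fb := ltr_phiM b0.
have ffa := phi_sqrM a; have ffb := phi_sqrM b.
have {}hj := one_to_four hj.
case: x => s z /andP[/= + +] /regular_step rs; rewrite !inE => hs hz.
apply/negPn/negP => nv.
have hsz : [\/ s = 2%N /\ z = b - f * a, s = 3%N /\ z = f * (b - a)
   | s = 4%N /\ z = f * b - a].
  case/or4P: hs hz nv => [/eqP->|/eqP->|/eqP->|/orP[/eqP->|/eqP->]] /=;
  rewrite /flow /next_side /= ltr_norml => hz; try case: ltP => ht;
  rewrite /valid /= -leNgt ler_normr /drift /= => nv;
  try (exfalso; lra); (case/orP: nv => nv; try (exfalso; lra)).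
  - by constructor 2; split=> //; lra.
  - by constructor 1; split=> //; lra.
  - by constructor 3; split=> //; lra.
move: (rs 0%N) (rs 1%N) (rs 2%N) (rs 3%N) => {rs hz nv}.
move: (iter 1 _ _) (iter 2 _ _) (iter 3 _ _) (iter 4 _ _) => y1 y2 y3 y4.
rewrite /renorm /=.
case: hsz => [] [-> ->]; case: hj => [->|[->|[->|->]]];
  rewrite /renorm_fst /renorm_snd; eval_labels; rewrite /=.
all: by do 4? (move=> /step_from /=; rewrite ?orbF; do ?[case/orP];
  case/andP=> /eqP hy; rewrite ?hy {hy} /drift /= => ?; try (exfalso; lra)).
Qed.
End Dynamics.

(** * Orbits and bands *)

Section Orbits.
Variable R : realType.
Variables a b : R.
Local Notation F := (flow a b).
Local Notation state := (state R).
Implicit Types x y : state.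

(** Two orbits with the same labels from some point on keep a constant transverse
    distance, see [same_itinerary_shift]; so labels alone express that two
    trajectories belong to one strip. *)
Definition parallel (x y : state) : Prop :=
  exists m : nat, forall k, (iter k F y).1 = (iter (m + k) F x).1.

Definition periodic (x : state) (n : nat) : Prop :=
  [/\ regular a b x, (0 < n)%N, iter n F x = x
    & forall m, (0 < m < n)%N -> iter m F x <> x].

Definition two_bands (x1 : state) (n1 : nat) (x2 : state) (n2 : nat) : Prop :=
  [/\ periodic x1 n1, periodic x2 n2, ~ parallel x1 x2
    & forall x, regular a b x -> parallel x1 x \/ parallel x2 x].

Lemma iter_step x k : regular a b x -> step a b (iter k F x) (F (iter k F x)).
Proof. exact: regular_step. Qed.

Lemma iter_flow_inj x y k : regular a b x -> regular a b y ->
  iter k F x = iter k F y -> x = y.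
Proof.
move=> rx ry; elim: k => [|k IH] //= h; apply: IH.
by apply: step_inj (iter_step k rx) _; rewrite h; apply: iter_step.
Qed.

Lemma same_itinerary_shift x y : regular a b x -> regular a b y ->
  (forall k, (iter k F x).1 = (iter k F y).1) ->
  forall k, (iter k F x).2 - (iter k F y).2 = x.2 - y.2.
Proof.
move=> rx ry h; elim=> [|k IH] //.
have /and4P[_ _ _ /eqP ex] := iter_step k rx.
have /and4P[_ _ _ /eqP ey] := iter_step k ry.
by rewrite !iterS ex ey -!iterS !h -IH; ring.
Qed.

Lemma periodic_iterM x n k : iter n F x = x -> iter (k * n) F x = x.
Proof. by move=> h; elim: k => // k IH; rewrite mulSn iterD IH h. Qed.

(** An orbit which ends up parallel to a periodic one is itself periodic, because
    its transverse distance to that one is constant and [flow] is injective. *)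
Lemma parallel_back x n y m : periodic x n -> regular a b y ->
  parallel x (iter m F y) -> parallel x y.
Proof.
move=> [rx n0 xn _] ry [p hp].
set u := iter m F y; set v := iter p F x.
have ru : regular a b u by apply: regular_iter.
have rv : regular a b v by apply: regular_iter.
have huv k : (iter k F u).1 = (iter k F v).1 by rewrite hp addnC iterD.
have vn : iter n F v = v by rewrite /v -iterD addnC iterD xn.
have un : iter n F u = u.
  have e1 : (iter n F u).1 = u.1 by rewrite huv vn -(huv 0%N).
  have := same_itinerary_shift ru rv huv n; rewrite vn => /addIr e2.
  by rewrite [LHS]surjective_pairing e1 e2 -surjective_pairing.
have yn : iter n F y = y.
  apply: (@iter_flow_inj _ _ m) => //; first exact: regular_iter.
  by rewrite -iterD addnC iterD -/u un.
have hm : (m <= m * n)%N by rewrite leq_pmulr.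
exists (p + (m * n - m))%N => k.
rewrite -{1}(periodic_iterM m yn) -iterD -{1}(subnK hm) addnA iterD -/u huv.
by rewrite -iterD; congr (iter _ _ _).1; lia.
Qed.

Lemma path_iter x s r : path (step a b) x s -> (r <= size s)%N ->
  iter r F x = nth x (x :: s) r.
Proof.
elim: s x r => [|y s IH] x [|r] // /andP[/flow_of_step h p] hr.
by rewrite iterSr h IH //; apply: set_nth_default.
Qed.

End Orbits.

(** * Renormalization of orbits *)

Section Refinement.
Variables (R : realType) (j : nat) (a b : R).
Hypotheses (a0 : 0 < a) (b0 : 0 < b) (hj : (1 <= j <= 4)%N).
Local Notation state := (state R).
Local Notation a' := (renorm_fst j a b).
Local Notation b' := (renorm_snd j a b).
Local Notation F := (flow a b).
Local Notation G := (flow a' b').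
Implicit Types x y : state.

(** [block_size x] new crossings replace the crossing x, and [block_start x k] of
    them precede the image of the k-th crossing of the orbit of x. *)
Definition block_size x : nat :=
  (size (path_between (shift_label j x.1) (shift_label j (F x).1))).+1.

Definition block_start x (k : nat) : nat := \sum_(i < k) block_size (iter i F x).

Lemma valid_label (c d : R) x : valid c d x -> x.1 \in side_labels.
Proof. by case/andP. Qed.

Lemma refine_iter x : step a b x (F x) ->
  [/\ iter (block_size x) G (renorm j x) = renorm j (F x),
      forall r, (r < block_size x)%N -> valid a' b' (iter r G (renorm j x)),
      forall r, (0 < r < block_size x)%N -> ~~ valid a b (unrenorm j (iter r G (renorm j x)))
    & forall r, (r < block_size x)%N -> (iter r G (renorm j x)).1 =
        nth 0%N (shift_label j x.1 ::
          path_between (shift_label j x.1) (shift_label j (F x).1)) r].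
Proof.
move=> h; have /andP[hp ha] := refine_step a0 b0 hj h.
have hs : block_size x = (size (inserted j a b x (F x))).+1 by rewrite /block_size size_scanl.
have hl : [seq u.1 | u <- inserted j a b x (F x)] =
    path_between (shift_label j x.1) (shift_label j (F x).1).
  rewrite /inserted; elim: (path_between _ _) (renorm j x) => //= t s IH u.
  by rewrite IH.
have hi r : (r < block_size x)%N ->
    iter r G (renorm j x) = nth (renorm j x) (renorm j x :: inserted j a b x (F x)) r.
  rewrite hs ltnS => hr; rewrite (path_iter hp) ?size_rcons; last by lia.
  by case: r hr => //= r hr; rewrite nth_rcons hr.
split.
- rewrite hs (path_iter hp) ?size_rcons //=.
  by rewrite nth_rcons ltnn eqxx.
- move=> r hr; rewrite hi //; rewrite hs in hr.
  move/(pathP (renorm j x))/(_ r): hp; rewrite size_rcons => /(_ hr) /and4P[+ _ _ _].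
  by case: r hr => //= r hr; rewrite nth_rcons -ltnS hr.
- move=> [|r] // hr; rewrite hi; last by lia.
  have hr' : (r < size (inserted j a b x (F x)))%N by move: hr; rewrite hs.
  exact: (allP ha _ (mem_nth (renorm j x) hr')).
- move=> r hr; rewrite hi // -hl.
  case: r hr => //= r; rewrite hs ltnS => hr.
  by rewrite (nth_map (renorm j x)).
Qed.

Lemma block_startS x k :
  block_start x k.+1 = (block_start x k + block_size (iter k F x))%N.
Proof. by rewrite /block_start big_ord_recr. Qed.

Lemma block_start_iter x k : regular a b x ->
  iter (block_start x k) G (renorm j x) = renorm j (iter k F x).
Proof.
move=> rx; elim: k => [|k IH]; first by rewrite /block_start big_ord0.
by rewrite block_startS addnC iterD IH; have [-> _ _ _] := refine_iter (iter_step k rx).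
Qed.

Lemma block_split x M : exists k r,
  (r < block_size (iter k F x))%N /\ M = (block_start x k + r)%N.
Proof.
elim: M => [|M [k [r [hr ->]]]]; first by exists 0%N, 0%N; rewrite /block_start big_ord0.
have [h|h] := ltnP r.+1 (block_size (iter k F x)); first by exists k, r.+1; rewrite addnS.
by exists k.+1, 0%N; rewrite block_startS addn0; split=> //; lia.
Qed.

Lemma ltn_block_start x k l : (k < l)%N -> (block_start x k < block_start x l)%N.
Proof.
elim: l => // l IH; rewrite ltnS leq_eqVlt block_startS => /orP[/eqP->|/IH];
  by rewrite /block_size; lia.
Qed.

Lemma leq_block_start x k l : (block_start x k <= block_start x l)%N = (k <= l)%N.
Proof.
have [kl|lk] := leqP k l; last first.
  by apply/negbTE; rewrite -ltnNge; apply: ltn_block_start.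
by move: kl; rewrite leq_eqVlt => /orP[/eqP->|/(ltn_block_start x)/ltnW ->//]; rewrite leqnn.
Qed.

Lemma iter_block_start x k r : regular a b x ->
  iter (block_start x k + r) G (renorm j x) = iter r G (renorm j (iter k F x)).
Proof. by move=> rx; rewrite addnC iterD block_start_iter. Qed.

Lemma refine_regular x : regular a b x -> regular a' b' (renorm j x).
Proof.
move=> rx M; have [k [r [hr ->]]] := block_split x M.
rewrite iter_block_start //.
by have [_ h _ _] := refine_iter (iter_step k rx); apply: h.
Qed.

Lemma kept_block_start x M : regular a b x ->
  valid a b (unrenorm j (iter M G (renorm j x))) -> exists k, M = block_start x k.
Proof.
move=> rx; have [k [[|r] [hr ->]]] := block_split x M; first by exists k; rewrite addn0.
rewrite iter_block_start //.
by have [_ _ h _] := refine_iter (iter_step k rx); rewrite (negbTE (h r.+1 hr)).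
Qed.

Lemma unrefine_regular x :
  valid a b x -> regular a' b' (renorm j x) -> regular a b x.
Proof.
move=> vx rx k.
suff: valid a b (iter k F x) /\ regular a' b' (renorm j (iter k F x)) by case.
elim: k => //= k [vk rk].
have vk1 := singular_refined a0 b0 hj vk rk; split=> //.
have [<- _ _ _] := refine_iter (step_flow vk vk1).
exact: regular_iter.
Qed.

Lemma kept_turn_iter y m : regular a' b' y ->
  valid a b (unrenorm j (iter m.+1 G y)) =
  ((iter m G y).1 == (iter m.+2 G y).1).
Proof.
by move=> ry; apply: (kept_turn a0 b0 hj); apply: regular_step.
Qed.

Lemma reaches_kept y : regular a' b' y ->
  exists m x, valid a b x /\ iter m G y = renorm j x.
Proof.
move=> ry.
have [k hk] : exists k, (iter k G y).1 = (iter k.+2 G y).1.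
  by apply: walk_turns => k; case/and4P: (regular_step k ry).
exists k.+1, (unrenorm j (iter k.+1 G y)); split.
  by rewrite kept_turn_iter // hk.
by rewrite unrenormK //; apply: valid_label (ry k.+1).
Qed.

Lemma refine_itinerary x y : regular a b x -> regular a b y ->
  (forall k, (iter k F x).1 = (iter k F y).1) ->
  forall k, (iter k G (renorm j x)).1 = (iter k G (renorm j y)).1.
Proof.
move=> rx ry h M.
have hd k : block_size (iter k F x) = block_size (iter k F y) by rewrite /block_size -!iterS !h.
have ht k : block_start x k = block_start y k by apply: eq_bigr => i _.
have [k [r [hr ->]]] := block_split x M.
rewrite iter_block_start // ht iter_block_start //.
have [_ _ _ ->//] := refine_iter (iter_step k rx).
have [_ _ _ ->//] := refine_iter (iter_step k ry); last by rewrite -hd.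
by rewrite -!iterS !h.
Qed.

Lemma renorm_label_inj x y : x.1 \in side_labels -> y.1 \in side_labels ->
  (renorm j x).1 = (renorm j y).1 -> x.1 = y.1.
Proof.
move=> hx hy h; rewrite -(renormK hj hx) -(renormK hj hy).
by rewrite /unrenorm /= in h *; rewrite h.
Qed.

(** The sandwiched letters are visible in the new labels, except at the initial
    crossing, which has no predecessor; so equal new labels have equal block
    boundaries, and the old labels are the letters found there. *)
Lemma unrefine_itinerary x y : regular a b x -> regular a b y ->
  (forall k, (iter k G (renorm j x)).1 = (iter k G (renorm j y)).1) ->
  forall k, (iter k F x).1 = (iter k F y).1.
Proof.
move=> rx ry h.
have rx' := refine_regular rx; have ry' := refine_regular ry.
have le u v k : regular a b u -> regular a b v ->
    (forall k, (iter k G (renorm j u)).1 = (iter k G (renorm j v)).1) ->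
    block_start u k = block_start v k -> (block_start v k.+1 <= block_start u k.+1)%N.
  move=> ru rv huv huk.
  have ru' := refine_regular ru; have rv' := refine_regular rv.
  have [M hM] : exists M, block_start u k.+1 = M.+1.
    by exists (block_start u k.+1).-1; rewrite prednK // block_startS /block_size; lia.
  have : valid a b (unrenorm j (iter (block_start u k.+1) G (renorm j u))).
    by have vu := ru k.+1; rewrite block_start_iter // renormK //; apply: valid_label vu.
  rewrite hM kept_turn_iter // !huv -kept_turn_iter // => /(kept_block_start rv)[l hl].
  rewrite hl leq_block_start ltnNge -(leq_block_start v) -huk -hl -hM -ltnNge.
  exact: ltn_block_start.
suff hk k : block_start x k = block_start y k.
  move=> k; apply: renorm_label_inj.
  - exact: valid_label (rx k).
  - exact: valid_label (ry k).
  by rewrite -!block_start_iter // h hk.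
elim: k => [|k IH]; first by rewrite /block_start !big_ord0.
by apply/eqP; rewrite eqn_leq !le.
Qed.

Lemma renorm_inj x y : x.1 \in side_labels -> y.1 \in side_labels ->
  renorm j x = renorm j y -> x = y.
Proof. by move=> hx hy h; rewrite -(renormK hj hx) h renormK. Qed.

Lemma refine_periodic x n :
  periodic a b x n -> periodic a' b' (renorm j x) (block_start x n).
Proof.
move=> [rx n0 xn hn]; split.
- exact: refine_regular.
- by have := ltn_block_start x n0; lia.
- by rewrite block_start_iter // xn.
- move=> M /andP[M0 hM] hMx.
  have [k hk] : exists k, M = block_start x k.
    have v := rx 0%N; apply: kept_block_start => //; rewrite hMx renormK //.
    exact: valid_label v.
  apply: (hn k).
    rewrite [(k < n)%N]ltnNge -(leq_block_start x n k) -hk -ltnNge hM andbT lt0n.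
    by apply: contraTneq M0 => k0; rewrite hk k0 /block_start big_ord0.
  apply: renorm_inj; [exact: valid_label (rx k)|exact: valid_label (rx 0%N)|].
  by rewrite -block_start_iter // -hk.
Qed.

(** Every new orbit reaches a sandwiched letter, from which it is the image of an
    old orbit; [parallel_back] takes care of the crossings before that letter. *)
Lemma refine_two_bands x1 n1 x2 n2 : two_bands a b x1 n1 x2 n2 ->
  two_bands a' b' (renorm j x1) (block_start x1 n1) (renorm j x2) (block_start x2 n2).
Proof.
move=> [p1 p2 np hall]; have q1 := refine_periodic p1; have q2 := refine_periodic p2.
split=> //.
- move=> [m hm]; apply: np.
  have [r1 _ _ _] := p1; have [r2 n20 x2n _] := p2.
  have [s1 _ _ _] := q1; have [s2 N20 x2N _] := q2.
  (* After a full period the crossing x2 recurs, now with a predecessor. *)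
  have [M hM] : exists M, block_start x2 n2 = M.+1.
    by exists (block_start x2 n2).-1; rewrite prednK.
  have : valid a b (unrenorm j (iter M.+1 G (renorm j x2))).
    by have v := r2 0%N; rewrite -hM x2N renormK //; apply: valid_label v.
  rewrite kept_turn_iter // !hm !addnS -kept_turn_iter // => /(kept_block_start r1)[k hk].
  exists k => i; rewrite addnC iterD.
  apply: (unrefine_itinerary r2 (regular_iter _ r1)) => {}i.
  rewrite -{1}x2N -iterD hm hM.
  have -> : (m + (i + M.+1) = block_start x1 k + i)%N by rewrite -hk; lia.
  by rewrite iter_block_start.
- move=> y ry; have [m [x [vx hmx]]] := reaches_kept ry.
  have rx : regular a b x.
    by apply: unrefine_regular => //; rewrite -hmx; apply: regular_iter.
  suff main z n : periodic a b z n -> parallel a b z x ->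
      parallel a' b' (renorm j z) y.
    by case: (hall x rx) => h; [left; apply: main p1 h|right; apply: main p2 h].
  move=> pz [k hk]; apply: (parallel_back (refine_periodic pz) ry (m := m)).
  have [rz _ _ _] := pz.
  exists (block_start z k) => i; rewrite iter_block_start // hmx.
  apply: refine_itinerary => //; first exact: regular_iter.
  by move=> {}i; rewrite hk addnC iterD.
Qed.

End Refinement.

(** * Lengths and words *)

Section Travel.
Variables (R : realType).
Local Notation state := (state R).

Definition itinerary (a b : R) (x : state) (n : nat) : seq nat :=
  mkseq (fun k => (iter k (flow a b) x).1) n.

(** A coordinate, chosen by [pr], of twice the path through the midpoints of the
    sides crossed; for a closed orbit this is twice its displacement. *)
Definition travel (a b : R) (pr : R * R -> R) (x : state) (n : nat) : R :=
  \sum_(k < n) pr (holonomy R (iter k (flow a b) x).1 (iter k.+1 (flow a b) x).1).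

Lemma travelS (a b : R) (pr : R * R -> R) (x : state) (n : nat) :
  travel a b pr x n.+1 = travel a b pr x n +
  pr (holonomy R (iter n (flow a b) x).1 (iter n.+1 (flow a b) x).1).
Proof. by rewrite /travel big_ord_recr. Qed.

Lemma travelD (a b : R) (pr : R * R -> R) (x : state) (m n : nat) :
  travel a b pr x (m + n) =
  travel a b pr x m + travel a b pr (iter m (flow a b) x) n.
Proof.
rewrite /travel big_split_ord; congr (_ + _); apply: eq_bigr => r _.
by rewrite -!iterD /= addnC.
Qed.

(** The drift is the determinant of (a, b) and of the holonomy; as z comes back to
    its initial value, the total holonomy is parallel to (a, b). *)
Lemma travel_closed (a b : R) (x : state) (n : nat) : iter n (flow a b) x = x ->
  a * travel a b snd x n = b * travel a b fst x n.
Proof.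
move=> xn.
have h k : (iter k (flow a b) x).2 = x.2 + (a * travel a b snd x k - b * travel a b fst x k).
  elim: k => [|k IH]; first by rewrite /travel !big_ord0; ring.
  by rewrite !travelS /= IH /drift; ring.
by have := h n; rewrite xn; lra.
Qed.

Lemma width_linear (a b c d e : R) s :
  width (e * a + c) (e * b + d) s = e * width a b s + width c d s.
Proof. by rewrite /width; case: s => [|[|[|[|[|?]]]]]; ring. Qed.

Lemma width0 s : width 0 0 s = 0 :> R.
Proof. by rewrite /width; case: s => [|[|[|[|[|?]]]]]; ring. Qed.

Variables (j : nat) (a b : R).
Hypotheses (a0 : 0 < a) (b0 : 0 < b) (hj : (1 <= j <= 4)%N).
Local Notation a' := (renorm_fst j a b).
Local Notation b' := (renorm_snd j a b).
Local Notation F := (flow a b).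
Local Notation G := (flow a' b').

Lemma refine_labels x r : step a b x (F x) -> (r <= block_size j a b x)%N ->
  (iter r G (renorm j x)).1 = nth 0%N (rcons (shift_label j x.1 ::
     path_between (shift_label j x.1) (shift_label j (F x).1))
     (shift_label j (F x).1)) r.
Proof.
move=> hx; have [h1 _ _ h2] := refine_iter a0 b0 hj hx.
rewrite leq_eqVlt nth_rcons => /orP[/eqP->|hr].
  by rewrite h1 ltnn eqxx.
by rewrite (h2 r hr) ifT.
Qed.

(** The holonomies of a chain add up to the image of the old holonomy under the
    linear map (a, b) -> (a', b'). *)
Lemma refine_holonomy x : step a b x (F x) ->
  \sum_(r < block_size j a b x) (holonomy R (iter r G (renorm j x)).1
     (iter r.+1 G (renorm j x)).1).1 =
  renorm_fst j (holonomy R x.1 (F x).1).1 (holonomy R x.1 (F x).1).2.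
Proof.
move=> hx; set L := rcons (shift_label j x.1 ::
     path_between (shift_label j x.1) (shift_label j (F x).1))
     (shift_label j (F x).1).
have ff := phi_sqr R.
transitivity (\sum_(r < block_size j a b x) (holonomy R (nth 0%N L r) (nth 0%N L r.+1)).1).
  by apply: eq_bigr => r _; rewrite !refine_labels //; case: r => r /= /ltnW.
have := hx => /and4P[_ _ /adjacentP ha _].
rewrite /block_size {}/L; case: ha.
all: case: (one_to_four hj) => [->|[->|[->|->]]].
all: rewrite /renorm_fst; eval_labels; rewrite /= !big_ord_recl big_ord0 /=; lra.
Qed.

(** By [travel_closed] the total holonomy is r (a, b) for some r, and by linearity
    it becomes r (a', b') with the same r. *)
Lemma travel_refine x n : regular a b x -> iter n F x = x ->
  travel a' b' fst (renorm j x) (block_start j a b x n) * a = travel a b fst x n * a'.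
Proof.
move=> rx xn.
have -> : travel a' b' fst (renorm j x) (block_start j a b x n) =
    renorm_fst j (travel a b fst x n) (travel a b snd x n).
  elim: n {xn} => [|n IH].
    by rewrite /block_start /travel !big_ord0 /renorm_fst width0.
  rewrite block_startS travelD IH (block_start_iter a0 b0 hj) // /travel.
  rewrite refine_holonomy; last exact: iter_step.
  rewrite -!/(travel _ _ _ _ _).
  rewrite !travelS /renorm_fst.
  by rewrite -[in RHS](mul1r (travel _ _ fst _ _)) -[in RHS](mul1r (travel _ _ snd _ _))
     width_linear mul1r.
rewrite mulrC /renorm_fst.
have := width_linear (travel a b fst x n) (travel a b snd x n) 0 0 a
  (shift_label (5 - j) 1).
rewrite width0 !addr0 => <-; rewrite (travel_closed xn).
have := width_linear a b 0 0 (travel a b fst x n) (shift_label (5 - j) 1).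
by rewrite width0 !addr0 => <-; congr width; ring.
Qed.

Lemma mkseqD (T : Type) (g : nat -> T) m d :
  mkseq g (m + d) = mkseq g m ++ mkseq (fun i => g (m + i)%N) d.
Proof. by rewrite /mkseq iotaD map_cat add0n -{2}[m]addn0 iotaDl -map_comp. Qed.

Lemma rot1_mkseq (T : Type) (g : nat -> T) n : g n = g 0%N ->
  rot 1 (mkseq g n) = mkseq (fun i => g i.+1) n.
Proof.
case: n => [|n] h //.
have -> : mkseq g n.+1 = g 0%N :: mkseq (fun i => g i.+1) n by exact: (mkseqD g 1 n).
by rewrite rot1_cons -h -[in RHS]addn1 mkseqD cats1 /mkseq /= addn0.
Qed.

Lemma itinerary_refine x n : regular a b x -> iter n F x = x ->
  itinerary a' b' (renorm j x) (block_start j a b x n) =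
  transform_word j (itinerary a b x n).
Proof.
move=> rx xn; rewrite /transform_word /fill_path /itinerary.
set l := fun k => shift_label j (iter k F x).1.
have -> : map (shift_label j) (mkseq (fun k => (iter k F x).1) n) = mkseq l n.
  by rewrite /mkseq -map_comp.
rewrite rot1_mkseq /l ?xn // /mkseq zip_map -map_comp -[LHS]/(mkseq _ _).
elim: n {xn} => [|n IH]; first by rewrite /block_start big_ord0.
rewrite block_startS mkseqD IH /mkseq -addn1 iotaD map_cat flatten_cat; congr (_ ++ _).
rewrite add0n [flatten _]/= cats0; set y := iter n F x.
have sy : step a b y (F y) by apply: iter_step.
apply: (@eq_from_nth _ 0%N) => [|r]; first by rewrite size_map size_iota.
rewrite size_map size_iota => hr.
rewrite (nth_map 0%N) ?size_iota // nth_iota // (iter_block_start a0 b0 hj) //.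
by have [_ _ _ ->] := refine_iter a0 b0 hj sy.
Qed.

End Travel.

Lemma fill_path_rot (i : nat) (v : seq nat) :
  cyclic_eq (fill_path v) (fill_path (rot i v)).
Proof.
rewrite /fill_path rot_rot; set v' := rot 1 v.
have sv : size v = size v' by rewrite size_rot.
have -> : zip (rot i v) (rot i v') = rot i (zip v v').
  rewrite /rot zip_cat ?size_drop ?sv //.
  by congr (_ ++ _); elim: i v v' sv => [|i IH] [|p v] [|q v'] //= [/IH->].
rewrite map_rot; set s := map _ _.
exists (size (flatten (take i s))).
have -> : flatten s = flatten (take i s) ++ flatten (drop i s).
  by rewrite -flatten_cat cat_take_drop.
by rewrite rot_size_cat /rot flatten_cat.
Qed.

Lemma transform_word_cyclic (j : nat) (w w' : seq nat) :
  cyclic_eq w w' -> cyclic_eq (transform_word j w) (transform_word j w').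
Proof. by case=> i ->; rewrite /transform_word map_rot; apply: fill_path_rot. Qed.

(** * Vertices of the ideal pentagons *)

Section Arcs.
Variable R : realType.
Local Notation f := (phi R).
Implicit Types (p q v : R * R) (m : nat).

(** The point - sin 36 cot theta of the direction v.1 e + v.2 e'. *)
Definition dir_point v : R := (1 - f / 2) * ((v.2 - v.1) / (v.1 + v.2)).

Definition dir_ideal v : option R :=
  if v.1 + v.2 == 0 then None else Some (dir_point v).

(** With p and q of determinant 1, the points [vertex p q m] for m = 0, ..., 4 are
    p, phi p + q, phi (p + q), p + phi q, q, and again any two consecutive ones
    have determinant 1, because phi ^ 2 - phi = 1. *)
Definition vertex p q m : R * R := (width p.1 q.1 m.+1, width p.2 q.2 m.+1).

Definition descend_vec (pq : (R * R) * (R * R)) m : (R * R) * (R * R) :=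
  (vertex pq.1 pq.2 m, vertex pq.1 pq.2 m.+1).

Definition sector_dirs : (R * R) * (R * R) := ((0, 1), (1, 0)).

Definition arc_vec (s : seq nat) := foldl descend_vec sector_dirs s.

Definition unimodular p q : Prop :=
  [/\ 0 <= p.1, 0 <= p.2, 0 <= q.1, 0 <= q.2 & p.2 * q.1 - p.1 * q.2 = 1].

Lemma dir_pointB v w : v.1 + v.2 != 0 -> w.1 + w.2 != 0 ->
  dir_point v - dir_point w =
  (1 - f / 2) * (2 * (v.2 * w.1 - v.1 * w.2) / ((v.1 + v.2) * (w.1 + w.2))).
Proof. by move=> hv hw; rewrite /dir_point; field; rewrite hv hw. Qed.

Lemma dir_ideal_opp v : dir_ideal (- v.1, - v.2) = dir_ideal v.
Proof.
rewrite /dir_ideal /= -opprD oppr_eq0; case: eqVneq => // h.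
by congr Some; rewrite /dir_point /=; field; rewrite -opprD oppr_eq0 h.
Qed.

(** The reflection in the geodesic with ends p and q is induced by the linear map
    which fixes p and negates q. *)
Lemma reflect_dir p q (x y : R) : p.1 + p.2 > 0 -> q.1 + q.2 > 0 ->
  dir_point p != dir_point q -> 0 <= x -> 0 <= y -> 0 < x + y ->
  reflect_ideal (dir_point p) (dir_point q)
    (dir_ideal (x * p.1 - y * q.1, x * p.2 - y * q.2)) =
  Some (dir_point (x * p.1 + y * q.1, x * p.2 + y * q.2)).
Proof.
set P := dir_point p; set Q := dir_point q; set s := p.1 + p.2; set t := q.1 + q.2.
move=> s0 t0 PQ x0 y0 xy.
have hP : P * s = (1 - f / 2) * (p.2 - p.1).
  by rewrite /P /dir_point -/s; field; rewrite gt_eqF.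
have hQ : Q * t = (1 - f / 2) * (q.2 - q.1).
  by rewrite /Q /dir_point -/t; field; rewrite gt_eqF.
have AB : 0 < x * s + y * t.
  have [xp|xn] := ltrP 0 x; first by rewrite ltr_pwDl ?mulr_gt0 ?mulr_ge0 // ltW.
  by rewrite ltr_wpDl ?mulr_gt0 ?mulr_ge0 ?(ltW s0) //; lra.
(* The point is the barycentre of P and Q with weights x s and z t, and the
   inversion negates the second weight. *)
have e z : dir_point (x * p.1 + z * q.1, x * p.2 + z * q.2) =
    (x * s * P + z * t * Q) / (x * s + z * t).
  rewrite /dir_point /= -[_ * s * P]mulrA [s * P]mulrC hP.
  rewrite -[_ * t * Q]mulrA [t * Q]mulrC hQ.
  have -> : x * p.1 + z * q.1 + (x * p.2 + z * q.2) = x * s + z * t.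
    by rewrite /s /t; ring.
  by ring.
have PQ' : P - Q != 0 by rewrite subr_eq0.
rewrite e /dir_ideal /=.
have -> : x * p.1 - y * q.1 + (x * p.2 - y * q.2) = x * s - y * t.
  by rewrite /s /t; ring.
have := e (- y); rewrite !mulNr => ->.
case: eqVneq => [h|h].
  rewrite /reflect_ideal; congr Some.
  have -> : x * s = y * t by apply/eqP; rewrite -subr_eq0 h.
  field.
  by apply: contraTneq AB => yt; rewrite -leNgt; lra.
have AB' : x * s + y * t != 0 by rewrite gt_eqF.
have d : (x * s * P - y * t * Q) / (x * s - y * t) - (P + Q) / 2 =
    (x * s + y * t) * (P - Q) / (2 * (x * s - y * t)).
  by field; rewrite h.
rewrite /reflect_ideal; case: eqVneq => [k|_].
  exfalso; move: d; rewrite k subrr => /esym/eqP.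
  rewrite !mulf_eq0 invr_eq0 mulf_eq0 (negbTE AB') (negbTE PQ') (negbTE h).
  by rewrite pnatr_eq0.
rewrite d; congr Some; field.
by rewrite PQ' h AB'.
Qed.

Definition vertices p q : seq (R * R) := [seq vertex p q m | m <- iota 0 5].

Lemma unimodular_gt0 p q : unimodular p q ->
  [/\ 0 < p.1 + p.2, 0 < q.1 + q.2, 0 < p.1 + q.1 & 0 < p.2 + q.2].
Proof. by case=> p1 p2 q1 q2 d; split; nra. Qed.

Lemma vertex_gt0 p q m : unimodular p q ->
  0 < (vertex p q m).1 + (vertex p q m).2.
Proof.
move=> /unimodular_gt0[hp hq _ _]; have f1 := phi_gt1 R.
rewrite /vertex /width; case: m => [|[|[|[|m]]]] //=; nra.
Qed.

Lemma vertex_unimodular p q m : unimodular p q -> (m <= 3)%N ->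
  unimodular (vertex p q m) (vertex p q m.+1).
Proof.
case=> p1 p2 q1 q2 d hm; have f1 := phi_gt1 R; have ff := phi_sqr R.
have e : (f * f - f) * (p.2 * q.1 - p.1 * q.2) = 1 by rewrite ff d; ring.
have f0 : 0 <= f by lra.
have := mulr_ge0 f0 p1; have := mulr_ge0 f0 p2.
have := mulr_ge0 f0 q1; have := mulr_ge0 f0 q2 => h1 h2 h3 h4.
by move: m hm => [|[|[|[|m]]]] // _; rewrite /vertex /width; split=> //=; lra.
Qed.

Lemma dir_point_gt v w : 0 < v.1 + v.2 -> 0 < w.1 + w.2 ->
  v.2 * w.1 - v.1 * w.2 = 1 -> dir_point w < dir_point v.
Proof.
move=> hv hw d; rewrite -subr_gt0 dir_pointB ?gt_eqF // d.
have f2 := phi_lt2 R.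
by rewrite !(mulr_gt0, invr_gt0) //; lra.
Qed.

Lemma reflect_vertex p q m : unimodular p q ->
  reflect_ideal (dir_point p) (dir_point q)
    (dir_ideal (vertex p (- q.1, - q.2) m)) = Some (dir_point (vertex p q m)).
Proof.
move=> u; have [hp hq _ _] := unimodular_gt0 u; have f1 := phi_gt1 R.
have PQ : dir_point p != dir_point q.
  by rewrite gt_eqF // dir_point_gt //; case: u.
pose x := width 1 0 m.+1 : R; pose y := width 0 1 m.+1 : R.
have [x0 y0 xy] : [/\ 0 <= x, 0 <= y & 0 < x + y].
  by rewrite /x /y /width; case: m {x y} => [|[|[|[|m]]]] /=; split; lra.
have -> : vertex p (- q.1, - q.2) m = (x * p.1 - y * q.1, x * p.2 - y * q.2).
  by rewrite /vertex /x /y /width; case: m {x y x0 y0 xy} => [|[|[|[|m]]]] /=;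
    congr pair; ring.
rewrite reflect_dir //; congr (Some (dir_point _)).
by rewrite /vertex /x /y /width; case: m {x y x0 y0 xy} => [|[|[|[|m]]]] /=;
  congr pair; ring.
Qed.

(** The vertices of the previous pentagon are those for p and - q. The determinants
    are positive, so that the reflected ones are already in decreasing order. *)
Lemma pentagon_acrossE (V : seq (option R)) p q : unimodular p q ->
  perm_eq V [seq dir_ideal v | v <- vertices p (- q.1, - q.2)] ->
  pentagon_across V (dir_point p) (dir_point q) =
  [seq dir_point v | v <- vertices p q].
Proof.
move=> u hV.
have e : pmap (reflect_ideal (dir_point p) (dir_point q))
    [seq dir_ideal v | v <- vertices p (- q.1, - q.2)] =
    [seq dir_point v | v <- vertices p q].
  by rewrite /vertices /= !reflect_vertex.
rewrite /pentagon_across.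
have /perm_sortP-> : perm_eq (pmap (reflect_ideal (dir_point p) (dir_point q)) V)
    [seq dir_point v | v <- vertices p q].
- by rewrite -e; apply: perm_pmap.
- apply: sorted_sort; first exact: ge_trans.
  have lt m : (m <= 3)%N -> dir_point (vertex p q m.+1) < dir_point (vertex p q m).
    move=> hm; apply: dir_point_gt; try exact: vertex_gt0.
    by case: (vertex_unimodular u hm).
  by rewrite /= !ltW // lt.
- by move=> x y; apply: ge_total.
- exact: ge_trans.
- by move=> x y /andP[/= yx xy]; apply/eqP; rewrite eq_le yx xy.
Qed.

Lemma next_pentagon p q m : (m <= 3)%N ->
  perm_eq [seq dir_ideal v | v <- vertices p q]
   [seq dir_ideal v | v <- vertices (vertex p q m)
      (- (vertex p q m.+1).1, - (vertex p q m.+1).2)].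
Proof.
have ff := phi_sqr R => hm.
have opp v w : w = v \/ w = (- v.1, - v.2) -> dir_ideal w = dir_ideal v.
  by case=> -> //; apply: dir_ideal_opp.
(* Across the side v_m v_(m+1) the old pentagon is read from v_m, turning away
   from v_(m+1); each vector agrees with a v_i up to sign. *)
pose s := nth [::] [:: [:: 0; 4; 3; 2; 1]; [:: 1; 0; 4; 3; 2];
  [:: 2; 1; 0; 4; 3]; [:: 3; 2; 1; 0; 4]]%N m.
have -> : [seq dir_ideal v | v <- vertices (vertex p q m)
    (- (vertex p q m.+1).1, - (vertex p q m.+1).2)] =
    [seq dir_ideal v | v <- [seq vertex p q i | i <- s]].
  have e x : (f * f) * x = f * x + x by rewrite ff; ring.
  have e1 := e p.1; have e2 := e p.2; have e3 := e q.1; have e4 := e q.2.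
  by rewrite {}/s /vertices; case: m hm => [|[|[|[|m]]]] // _ /=;
    do 5 (apply: (f_equal2 cons); first by apply: opp; rewrite /vertex /width /=;
    first [left; congr pair; lra | right; congr pair; lra]).
apply/perm_map/perm_map; rewrite {}/s.
by move: m hm => [|[|[|[|m]]]].
Qed.

Lemma descendP (V : seq (option R)) p q m : unimodular p q -> (m <= 3)%N ->
  perm_eq V [seq dir_ideal v | v <- vertices p (- q.1, - q.2)] ->
  let VI := descend (V, (dir_point p, dir_point q)) m in
  VI.2 = (dir_point (vertex p q m), dir_point (vertex p q m.+1)) /\
  perm_eq VI.1 [seq dir_ideal v | v <- vertices (vertex p q m)
      (- (vertex p q m.+1).1, - (vertex p q m.+1).2)].
Proof.
move=> u hm hV; rewrite /descend /= (pentagon_acrossE u hV); split.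
  by move: m hm => [|[|[|[|m]]]].
apply: perm_trans (next_pentagon p q hm).
have e i : Some (dir_point (vertex p q i)) = dir_ideal (vertex p q i).
  by rewrite /dir_ideal gt_eqF ?vertex_gt0.
by rewrite /= !e.
Qed.

Lemma arc_vecP (s : seq nat) : all (fun d => d <= 3)%N s ->
  unimodular (arc_vec s).1 (arc_vec s).2 /\
  Defs.arc R s = (dir_point (arc_vec s).1, dir_point (arc_vec s).2).
Proof.
have f1 := phi_gt1 R; have ff := phi_sqr R.
rewrite /Defs.arc /arc_vec; set pq := sector_dirs; set VI := (_, _).
have : unimodular pq.1 pq.2 by split=> /=; lra.
have : VI.2 = (dir_point pq.1, dir_point pq.2).
  by rewrite /= /dir_point /=; congr pair; field.
have : perm_eq VI.1 [seq dir_ideal v | v <- vertices pq.1 (- pq.2.1, - pq.2.2)].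
  rewrite /VI /vertices /pentagon0 /= /vertex /width /dir_ideal /dir_point /=.
  rewrite !(oppr0, mulr0, addr0, add0r, mulr1, mulrN1, mulrN).
  have n1 : -1 + f != 0 by rewrite gt_eqF //; lra.
  have n2 : - f + 1 != 0 by rewrite lt_eqF //; lra.
  rewrite (negbTE n1) (negbTE n2) oner_eq0 oppr_eq0 oner_eq0 addNr eqxx.
  have -> : (1 - f / 2) * (1 / 1) = 1 - f / 2 by field.
  have -> : (1 - f / 2) * (- (-1) / -1) = f / 2 - 1 by field.
  have -> : (1 - f / 2) * ((f - -1) / (-1 + f)) = f / 2.
    by apply: (mulIf n1); rewrite mulrA divfK //; lra.
  have -> // : (1 - f / 2) * ((1 - - f) / (- f + 1)) = - (f / 2).
  by apply: (mulIf n2); rewrite mulrA divfK //; lra.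
elim: s pq VI => //= m s IH pq VI hV hI u /andP[hm hs].
move: VI hI hV => [V I] /= -> hV.
have [h2 h1] := descendP u hm hV.
by apply: IH => //; apply: vertex_unimodular.
Qed.

Lemma width_width (a b c d : R) s t :
  width (width a b t) (width c d t) s = width (width a c s) (width b d s) t.
Proof.
by rewrite /width; case: s => [|[|[|[|[|?]]]]]; case: t => [|[|[|[|[|?]]]]]; ring.
Qed.

Lemma width_swap (a b : R) m : (m <= 4)%N ->
  width b a (4 - m).+1 = width a b m.+1.
Proof. by rewrite /width; case: m => [|[|[|[|[|m]]]]] //= _; ring. Qed.

Definition renorm_dir (j : nat) v : R * R := (renorm_fst j v.1 v.2, renorm_snd j v.1 v.2).

Lemma renorm_dir_vertex j p q m :
  renorm_dir j (vertex p q m) = vertex (renorm_dir j p) (renorm_dir j q) m.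
Proof. by rewrite /renorm_dir /vertex /renorm_fst /renorm_snd !(width_width _ _ _ _ m.+1). Qed.

Lemma vertex_swap p q m : (m <= 4)%N -> vertex q p (4 - m) = vertex p q m.
Proof. by move=> hm; rewrite /vertex !width_swap. Qed.

(** Linearity lets the renormalization pass through all the steps, and the exchange
    of the end points of the arcs turns the digit d into 3 - d. *)
Lemma arc_vec_renorm j (n : seq nat) : (1 <= j <= 4)%N ->
  all (fun d => d <= 3)%N n ->
  arc_vec ((j - 1)%N :: [seq (3 - d)%N | d <- n]) =
  (renorm_dir j (arc_vec n).2, renorm_dir j (arc_vec n).1).
Proof.
move=> hj; rewrite /arc_vec /=.
have -> : descend_vec sector_dirs (j - 1) =
    (renorm_dir j sector_dirs.2, renorm_dir j sector_dirs.1).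
  have {}hj := one_to_four hj.
  rewrite /descend_vec /renorm_dir /vertex /renorm_fst /renorm_snd.
  by case: hj => [->|[->|[->|->]]]; eval_labels; rewrite /width /=;
    congr (_, _, (_, _)); ring.
move: sector_dirs => pq; elim: n pq => //= d n IH pq /andP[hd hn].
rewrite -IH //; congr (foldl _ _ _); rewrite /descend_vec /=.
rewrite -(vertex_swap (renorm_dir j pq.2) (renorm_dir j pq.1)) ?leq_subLR //; last lia.
rewrite -(vertex_swap (renorm_dir j pq.2) (renorm_dir j pq.1) (m := (3 - d).+1)); last lia.
rewrite !renorm_dir_vertex; congr (vertex _ _ _, vertex _ _ _); lia.
Qed.

(** The last digit is n_k -> 4 - n_k because it selects a vertex and not an arc;
    it is not 0, so the direction lies strictly inside the sector. *)
Lemma alpha_directionP (n : seq nat) (nk : nat) :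
  all (fun d => d <= 3)%N n -> (1 <= nk <= 3)%N ->
  exists a b : R, [/\ 0 < a, 0 < b, alpha R (rcons n nk) = dir_point (a, b) &
    forall j, (1 <= j <= 4)%N ->
    alpha R ((j - 1)%N :: rcons [seq (3 - d)%N | d <- n] (4 - nk)%N) =
    dir_point (renorm_dir j (a, b))].
Proof.
move=> hn hnk; have nk3 : (nk <= 3)%N by case/andP: hnk.
have nk4 : (4 - nk <= 3)%N by lia.
have hm : all (fun d => d <= 3)%N [seq (3 - d)%N | d <- n].
  by rewrite all_map; apply/allP => d _ /=; apply: leq_subr.
have hj3 (j : nat) : (1 <= j <= 4)%N -> (j - 1 <= 3)%N by lia.
set p := (arc_vec n).1; set q := (arc_vec n).2.
have [u _] := arc_vecP hn.
exists (vertex p q nk).1, (vertex p q nk).2.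
have [_ _ h1 h2] := unimodular_gt0 u; have [p1 p2 q1 q2 _] := u.
have f1 := phi_gt1 R.
have [v1 v2] : 0 < (vertex p q nk).1 /\ 0 < (vertex p q nk).2.
  move: hnk; rewrite -/p -/q /vertex /width in h1 h2 p1 p2 q1 q2 *.
  by case: nk {nk3 nk4} => [|[|[|[|nk]]]] //= _; split; nra.
split=> //.
  rewrite /alpha (arc_vecP _).2 ?all_rcons ?hn ?nk3 //.
  by rewrite /arc_vec foldl_rcons.
move=> j hj; rewrite /alpha -rcons_cons (arc_vecP _).2; last first.
  by rewrite all_rcons /= nk4 hj3.
rewrite /arc_vec foldl_rcons -/(arc_vec _) arc_vec_renorm //= vertex_swap ?(leqW nk3) //.
by rewrite -renorm_dir_vertex -/p -/q; congr (dir_point (renorm_dir j _)); case: (vertex _ _ _).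
Qed.

End Arcs.

(** * The pentagon in the basis (e, e') *)

Section Geometry.
Variable R : realType.
Local Notation f := (phi R).
Local Notation state := (state R).

(** The angle t = pi / 5 satisfies cos (3 t) = - cos (2 t). *)
Lemma cos_pi5 : cos (pi / 5) = f / 2 :> R.
Proof.
set t : R := pi / 5; set c := cos t.
have pi0 := pi_gt0 R.
have c0 : 0 < c by apply: cos_gt0_pihalf; rewrite /t; apply/andP; split; lra.
have c2 : cos (t + t) = 2 * c ^+ 2 - 1 by rewrite cosD -!expr2 sin2cos2 -/c; ring.
have c3 : cos (t + t + t) = 4 * c ^+ 3 - 3 * c.
  rewrite cosD c2 sinD -/c.
  have -> : (sin t * c + c * sin t) * sin t = 2 * c * sin t ^+ 2 by ring.
  by rewrite sin2cos2 -/c; ring.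
have : cos (t + t + t) = - cos (t + t).
  by rewrite -cosDpi -cosN -(cosD2pi _); congr cos; rewrite /t; field.
rewrite c2 c3 => h.
have {}h : (c + 1) * (4 * c ^+ 2 - 2 * c - 1) = 0.
  by rewrite -[RHS](subrr (4 * c ^+ 3 - 3 * c)) {2}h; ring.
have {h} h2 : 4 * c ^+ 2 - 2 * c - 1 = 0.
  by move/eqP: h; rewrite mulf_eq0 => /orP[/eqP|/eqP//]; lra.
have ff := phi_sqr R; have f1 := phi_gt1 R.
have : (2 * c - f) * (2 * c + f - 1) = 0 by nra.
by move/eqP; rewrite mulf_eq0 => /orP[] /eqP; lra.
Qed.

Lemma sin_pi5_gt0 : 0 < sin (pi / 5) :> R.
Proof. by have := pi_gt0 R; move=> h; apply: sin_gt0_pi; apply/andP; split; lra. Qed.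

Lemma cos_2pi5 : cos (2 * pi / 5) = (f - 1) / 2 :> R.
Proof.
have -> : 2 * pi / 5 = pi / 5 + pi / 5 :> R by ring.
rewrite cosD -!expr2 sin2cos2 cos_pi5; have := phi_sqr R; lra.
Qed.

Lemma sin_2pi5 : sin (2 * pi / 5) = f * sin (pi / 5) :> R.
Proof.
have -> : 2 * pi / 5 = pi / 5 + pi / 5 :> R by ring.
by rewrite sinD cos_pi5; field.
Qed.

Definition frame (u : R * R) : plane R :=
  (cos (2 * pi / 5) * (u.1 - u.2), sin (2 * pi / 5) * (u.1 + u.2)).

(** The corners of P in the basis (e, e'); the corner 5 is the corner 0 again. *)
Definition corner (i : nat) : R * R :=
  match i with
  | 1%N => (f, - f) | 2%N => (f + 1, - f) | 3%N => (f, 0) | 4%N => (0, 1)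
  | _ => (0, 0)
  end.

Lemma pent_vertexE i : (i <= 5)%N -> pent_vertex R i = frame (corner i).
Proof.
have pi0 := pi_gt0 R; have ff := phi_sqr R.
have e0 : unit_vec (0 * (2 * pi / 5)) = (1, 0) :> plane R.
  by rewrite /unit_vec mul0r cos0 sin0.
have e1 : unit_vec (1 * (2 * pi / 5)) = ((f - 1) / 2, f * sin (pi / 5)) :> plane R.
  by rewrite /unit_vec mul1r cos_2pi5 sin_2pi5.
have e2 : unit_vec (2 * (2 * pi / 5)) = (- (f / 2), sin (pi / 5)) :> plane R.
  rewrite /unit_vec; have -> : 2 * (2 * pi / 5) = - (pi / 5) + pi :> R by field.
  by rewrite cosDpi sinDpi cosN sinN cos_pi5 opprK.
have e3 : unit_vec (3 * (2 * pi / 5)) = (- (f / 2), - sin (pi / 5)) :> plane R.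
  rewrite /unit_vec; have -> : 3 * (2 * pi / 5) = pi / 5 + pi :> R by field.
  by rewrite cosDpi sinDpi cos_pi5.
have e4 : unit_vec (4 * (2 * pi / 5)) = ((f - 1) / 2, - (f * sin (pi / 5))) :> plane R.
  rewrite /unit_vec; have -> : 4 * (2 * pi / 5) = - (2 * pi / 5) + pi *+ 2 :> R.
    by rewrite mulr2n; field.
  by rewrite cosD2pi sinD2pi cosN sinN cos_2pi5 sin_2pi5.
rewrite /pent_vertex /frame cos_2pi5 sin_2pi5.
have fs : f * f * sin (pi / 5) = f * sin (pi / 5) + sin (pi / 5) by rewrite ff; ring.
case: i => [|[|[|[|[|[|i]]]]]] // _; rewrite ?big_ord_recr big_ord0 /= ?e0 ?e1 ?e2 ?e3 ?e4.
all: by congr pair; rewrite /=; lra.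
Qed.

Lemma frame_inj u v : frame u = frame v -> u = v.
Proof.
have f1 := phi_gt1 R; have s0 := sin_pi5_gt0.
case: u v => [x y] [x' y'] [/= h1 h2].
have c0 : cos (2 * pi / 5) != 0 :> R by rewrite cos_2pi5 gt_eqF //; lra.
have c1 : sin (2 * pi / 5) != 0 :> R.
  by rewrite sin_2pi5 gt_eqF // mulr_gt0 //; lra.
have := mulfI c0 h1; have := mulfI c1 h2 => h3 h4.
by congr pair; lra.
Qed.

Definition side_pt (l : nat) (t : R) : R * R :=
  let u := corner (index l side_labels) in
  let v := corner (index l side_labels).+1 in
  ((1 - t) * u.1 + t * v.1, (1 - t) * u.2 + t * v.2).

Definition scale (r : R) (u : R * R) : R * R := (r * u.1, r * u.2).

Lemma planeZ (t x y : R) : t *: ((x, y) : plane R) = (t * x, t * y).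
Proof. by []. Qed.

Lemma planeD (x y x' y' : R) :
  ((x, y) : plane R) + (x', y') = (x + x', y + y') :> plane R.
Proof. by []. Qed.

Lemma planeN (x y : R) : - ((x, y) : plane R) = (- x, - y) :> plane R.
Proof. by []. Qed.

Lemma side_ptE l t : l \in side_labels ->
  (1 - t) *: side_src R l + t *: side_dst R l = frame (side_pt l t).
Proof.
move=> hl; have hi : (index l side_labels < 5)%N by rewrite -index_mem in hl.
rewrite /side_src /side_dst !pent_vertexE ?(ltnW hi) //.
by rewrite /frame /side_pt !planeZ planeD /=; congr pair; ring.
Qed.

Lemma frame_scale r u : r *: frame u = frame (scale r u).
Proof. by rewrite /frame /scale planeZ; congr pair; rewrite /=; ring. Qed.

Lemma on_sideP b l p : on_side b l p <->
  l \in side_labels /\ exists t, [/\ 0 < t, t < 1 &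
    p = frame (scale (pent_sign R b) (side_pt l t))].
Proof.
split=> -[hl [t [t0 t1 ->]]]; split=> //; exists t; split=> //;
  by rewrite ?side_ptE // frame_scale ?side_ptE.
Qed.

(** The gluing of a side reverses its counterclockwise parametrization. *)
Lemma glueE b l t : l \in side_labels ->
  Defs.glue b l (frame (scale (pent_sign R b) (side_pt l t))) =
  frame (scale (pent_sign R (~~ b)) (side_pt l (1 - t))).
Proof.
move=> hl; have hi : (index l side_labels < 5)%N by rewrite -index_mem in hl.
rewrite /Defs.glue /side_src /side_dst !pent_vertexE ?(ltnW hi) //.
rewrite /frame /scale /side_pt /= planeD planeZ planeN planeD /pent_sign.
by case: b; congr pair; ring.
Qed.

(** The sides of P through which a trajectory going upwards leaves it. *)
Definition top_side (s : nat) : bool := s \in [:: 2; 4]%N.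

(** If two sides which are not joined in the path graph were linked by a chord, the
    coordinates of that chord would have opposite signs. *)
Lemma chord_step (a b r t u : R) (s s' : nat) : 0 < a -> 0 < b ->
  0 < t < 1 -> 0 < u < 1 -> s \in side_labels -> s' \in side_labels -> s != s' ->
  (side_pt s' (1 - u)).1 - (side_pt s t).1 = r * a ->
  (side_pt s' (1 - u)).2 - (side_pt s t).2 = r * b ->
  step a b (s, (2 * t - 1) * width a b s) (s', (2 * u - 1) * width a b s') /\
  (if top_side s then r < 0 else 0 < r).
Proof.
move=> a0 b0 ht hu hs hs' ss' hX hY.
have f1 := phi_gt1 R.
have w0 l : 0 < width a b l by rewrite /width; case: l => [|[|[|[|[|?]]]]]; nra.
have v l z : l \in side_labels -> 0 < z < 1 ->
    valid a b (l, (2 * z - 1) * width a b l).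
  move=> hl hz; rewrite /valid hl /= normrM (gtr0_norm (w0 l)) gtr_pMl //.
  by rewrite ltr_norml; lra.
have tri : [\/ [/\ r < 0, r * a < 0 & r * b < 0], [/\ 0 < r, 0 < r * a & 0 < r * b]
    | r * a = 0 /\ r * b = 0].
  case: (ltrgtP r 0) => hr.
  - by constructor 1; rewrite !nmulr_rlt0.
  - by constructor 2; rewrite !pmulr_rgt0.
  - by constructor 3; rewrite hr !mul0r.
have f0 : 0 < f by lra.
have ft0 : 0 < f * t by rewrite mulr_gt0 //; lra.
have ft1 : 0 < f * (1 - t) by rewrite mulr_gt0 //; lra.
have fu0 : 0 < f * u by rewrite mulr_gt0 //; lra.
have fu1 : 0 < f * (1 - u) by rewrite mulr_gt0 //; lra.
have hXY : b * ((side_pt s' (1 - u)).1 - (side_pt s t).1) =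
    a * ((side_pt s' (1 - u)).2 - (side_pt s t).2) by rewrite hX hY; ring.
rewrite /step !v //=.
move: hXY hX hY ss'.
move: hs hs'; rewrite !inE => hs hs'.
case/or4P: hs => [/eqP->|/eqP->|/eqP->|/orP[/eqP->|/eqP->]];
case/or4P: hs' => [/eqP->|/eqP->|/eqP->|/orP[/eqP->|/eqP->]] //;
rewrite /side_pt /corner /= => hXY hX hY _.
all: case: tri => [[r0 ra rb]|[r0 ra rb]|[ra rb]]; try (exfalso; lra).
all: by split=> //; apply/eqP; rewrite /drift /=; lra.
Qed.

End Geometry.

(** * Trajectories as orbits *)

Section Coding.
Variable R : realType.
Local Notation f := (phi R).
Local Notation state := (state R).

Lemma width_gt0 (a b : R) l : 0 < a -> 0 < b -> 0 < width a b l.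
Proof.
have f1 := phi_gt1 R => a0 b0.
by rewrite /width; case: l => [|[|[|[|[|?]]]]]; nra.
Qed.

Lemma step_chord (a b : R) (s s' : nat) (t u : R) : 0 < a -> 0 < b ->
  0 < t < 1 -> 0 < u < 1 ->
  step a b (s, (2 * t - 1) * width a b s) (s', (2 * u - 1) * width a b s') ->
  exists r, [/\ (side_pt s' (1 - u)).1 - (side_pt s t).1 = r * a,
    (side_pt s' (1 - u)).2 - (side_pt s t).2 = r * b &
    if top_side s then r < 0 else 0 < r].
Proof.
move=> a0 b0 ht hu /and4P[_ _ /= /adjacentP ha /eqP hd].
have f1 := phi_gt1 R; have f0 : 0 < f by lra.
have ft0 : 0 < f * t by rewrite mulr_gt0 //; lra.
have ft1 : 0 < f * (1 - t) by rewrite mulr_gt0 //; lra.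
have fu0 : 0 < f * u by rewrite mulr_gt0 //; lra.
have fu1 : 0 < f * (1 - u) by rewrite mulr_gt0 //; lra.
set X := _ - _; set Y := (side_pt s' (1 - u)).2 - _.
have XY : b * X = a * Y.
  by rewrite /X /Y; case: ha hd => /=; rewrite /drift /side_pt /corner /=; lra.
have ra : X = X / a * a by rewrite divfK ?gt_eqF.
have rb : Y = X / a * b.
  by apply: (mulfI (lt0r_neq0 a0)); rewrite -XY; field; rewrite gt_eqF.
exists (X / a); split=> //.
case: (ltrgtP (X / a) 0) => hr.
- have : X < 0 by rewrite ra nmulr_rlt0.
  have : Y < 0 by rewrite rb nmulr_rlt0.
  by rewrite /X /Y; case: ha => /=; rewrite /side_pt /corner /=; lra.
- have : 0 < X by rewrite ra pmulr_rgt0.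
  have : 0 < Y by rewrite rb pmulr_rgt0.
  by rewrite /X /Y; case: ha => /=; rewrite /side_pt /corner /=; lra.
- have : X = 0 by rewrite ra hr mul0r.
  have : Y = 0 by rewrite rb hr mul0r.
  by rewrite /X /Y; case: ha => /=; rewrite /side_pt /corner /=; lra.
Qed.

Lemma side_pt_inj l (t t' : R) : l \in side_labels ->
  side_pt l t = side_pt l t' -> t = t'.
Proof.
have f1 := phi_gt1 R.
rewrite !inE /side_pt => /or4P[/eqP->|/eqP->|/eqP->|/orP[/eqP->|/eqP->]] /= [h1 h2].
all: have h : f * t = f * t' \/ t = t' by (right; lra) || (left; lra).
all: by case: h => // /mulfI; apply; rewrite gt_eqF //; lra.
Qed.

(** The parameter of the crossing point on the entry side, counterclockwise along
    the boundary of the pentagon which the trajectory enters. *)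
Definition side_par (a b : R) (x : state) : R := (x.2 / width a b x.1 + 1) / 2.

Lemma side_parP (a b : R) (x : state) : 0 < a -> 0 < b -> valid a b x ->
  0 < side_par a b x < 1 /\ x = (x.1, (2 * side_par a b x - 1) * width a b x.1).
Proof.
move=> a0 b0 /andP[_]; case: x => s z /= hz.
have w0 := width_gt0 s a0 b0.
have e : z = (2 * side_par a b (s, z) - 1) * width a b s.
  by rewrite /side_par /=; field; rewrite gt_eqF.
rewrite -e; split=> //; move: hz; rewrite /side_par /= ltr_norml => /andP[h1 h2].
have : -1 < z / width a b s by rewrite ltr_pdivlMr // mulN1r.
have : z / width a b s < 1 by rewrite ltr_pdivrMr // mul1r.
lra.
Qed.

End Coding.

Section Trajectories.
Variable R : realType.
Local Notation state := (state R).
Variables (a b : R).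
Hypotheses (a0 : 0 < a) (b0 : 0 < b).
Variables (theta kappa : R) (sigma : bool).
Hypothesis (k0 : 0 < kappa).
Hypothesis theta_dir : unit_vec theta = frame (scale ((-1) ^+ sigma * kappa) (a, b)).
Local Notation F := (flow a b).

(** [sigma] tells whether the trajectories go downwards; the two cases are exchanged
    by the central symmetry, which exchanges P and P'. *)
Definition pent_of (s : nat) : bool := top_side s (+) sigma.

Definition chord_of (x : state) : chord R :=
  Chord (pent_of x.1) x.1
    (frame (scale (pent_sign R (pent_of x.1)) (side_pt x.1 (side_par a b x))))
    ((-1) ^+ top_side x.1 * ((side_pt (F x).1 (1 - side_par a b (F x))).1 -
       (side_pt x.1 (side_par a b x)).1) / (kappa * a)).

Definition traj (x : state) (k : nat) : chord R := chord_of (iter k F x).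

Lemma frameD u v : frame u + frame v = frame (u.1 + v.1, u.2 + v.2) :> plane R.
Proof. by rewrite /frame planeD /=; congr pair; ring. Qed.

Lemma adjacent_top s s' : adjacent s s' -> top_side s' = ~~ top_side s.
Proof. by move=> /adjacentP[]. Qed.

Lemma pent_sign_top s :
  pent_sign R (pent_of s) * (-1) ^+ sigma = (-1) ^+ top_side s.
Proof.
rewrite /pent_sign /pent_of; case: (top_side s); case: sigma => /=; ring.
Qed.

(** In the coordinates of P, a chord which enters through a top side runs downwards,
    whence the sign in front of r. *)
Lemma chord_coords (p p' : R * R) (s : nat) (l r : R) :
  p'.1 - p.1 = r * a -> p'.2 - p.2 = r * b ->
  l = (-1) ^+ top_side s * r / kappa ->
  frame (scale (pent_sign R (pent_of s)) p) + l *: unit_vec theta =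
  frame (scale (pent_sign R (pent_of s)) p').
Proof.
move=> h1 h2 ->; rewrite theta_dir frame_scale frameD /scale /=.
rewrite -pent_sign_top; set e := pent_sign _ _; set g := (-1) ^+ sigma.
have gg : g * g = 1 by rewrite /g -signr_addb addbb.
have k1 : kappa != 0 by rewrite gt_eqF.
have c z : e * g * r / kappa * (g * kappa * z) = e * (r * z).
  have -> : e * g * r / kappa * (g * kappa * z) = (g * g) * (e * (r * z)).
    by field.
  by rewrite gg mul1r.
by rewrite !c -h1 -h2; congr (frame (_, _)); ring.
Qed.

Lemma regular_trajectory x : regular a b x -> trajectory theta (traj x).
Proof.
move=> rx k; rewrite /traj iterS; set y := iter k F x.
have hs : step a b y (F y) by apply: regular_step.
have /and4P[vy vz adj _] := hs.
have [ht ey] := side_parP a0 b0 vy; have [hu ez] := side_parP a0 b0 vz.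
have := hs; rewrite {1}ey {1}ez => /(step_chord a0 b0 ht hu)[r [hX hY hr]].
have e : chord_end theta (chord_of y) = frame (scale (pent_sign R (pent_of y.1))
    (side_pt (F y).1 (1 - side_par a b (F y)))).
  by apply: (chord_coords hX hY); rewrite /= hX; field; rewrite !gt_eqF.
split.
- apply/on_sideP; split; first exact: valid_label vy.
  by exists (side_par a b y); split=> //; lra.
- have -> : len (chord_of y) = (-1) ^+ top_side y.1 * r / kappa.
    by rewrite /= hX; field; rewrite !gt_eqF.
  by rewrite divr_gt0 //; case: (top_side y.1) hr => hr; rewrite ?expr1 ?expr0; lra.
- by move: adj => /adjacentP /=; case.
- rewrite e; apply/on_sideP; split; first exact: valid_label vz.
  by exists (1 - side_par a b (F y)); split=> //; lra.
- rewrite e /= glueE ?(valid_label vz) //; split.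
    by rewrite /pent_of (adjacent_top adj) addNb.
  rewrite /pent_of (adjacent_top adj) addNb; congr (frame (scale _ (side_pt _ _))).
  by ring.
Qed.

Lemma pent_sign_neq0 c : pent_sign R c != 0.
Proof. by rewrite /pent_sign signr_eq0. Qed.

Lemma scale_inj e u v : e != 0 -> scale e u = scale e v -> u = v :> R * R.
Proof. by case: u v => [x y] [x' y'] h [/(mulfI h)-> /(mulfI h)->]. Qed.

Lemma trajectory_regular c : trajectory theta c ->
  exists x, regular a b x /\ forall k, c k = traj x k.
Proof.
move=> hc.
have /choice[t ht] : forall k, exists t, [/\ 0 < t, t < 1 &
    start (c k) = frame (scale (pent_sign R (pent (c k))) (side_pt (entry (c k)) t))].
  by move=> k; case: (hc k) => /on_sideP[_].
have hl k : entry (c k) \in side_labels by case: (hc k) => /on_sideP[].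
pose z k : state := (entry (c k), (2 * t k - 1) * width a b (entry (c k))).
have pz k : side_par a b (z k) = t k.
  by rewrite /side_par /=; field; rewrite gt_eqF ?width_gt0.
have main k : step a b (z k) (z k.+1) /\ c k = Chord (pent_of (z k).1) (z k).1
    (frame (scale (pent_sign R (pent_of (z k).1)) (side_pt (z k).1 (t k))))
    ((-1) ^+ top_side (z k).1 * ((side_pt (z k.+1).1 (1 - t k.+1)).1 -
       (side_pt (z k).1 (t k)).1) / (kappa * a)).
  have [_ l0 neq /on_sideP[_ [t' [t0' t1' et]]] [ep es]] := hc k.
  have [tk0 tk1 ek] := ht k; have [tl0 tl1 el] := ht k.+1.
  set e := pent_sign R (pent (c k)) in ek et.
  have tt : t' = 1 - t k.+1.
    move: es; rewrite et glueE // el ep => /frame_inj.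
    by move=> /(scale_inj (pent_sign_neq0 _)) /(side_pt_inj (hl _)); lra.
  have ee : e * e = 1 by rewrite /e /pent_sign -signr_addb addbb.
  set r := e * (-1) ^+ sigma * (len (c k) * kappa).
  set p := side_pt _ (t k) in ek; set p' := side_pt _ t' in et.
  have [hX hY] : p'.1 - p.1 = r * a /\ p'.2 - p.2 = r * b.
    clearbody p p'; move: et; rewrite /chord_end ek theta_dir frame_scale frameD => /frame_inj.
    rewrite /scale /= => -[h1 h2]; split.
      have -> : p'.1 = e * (e * p'.1) by rewrite mulrA ee mul1r.
      by rewrite -h1 mulrDr mulrA ee mul1r /r; ring.
    have -> : p'.2 = e * (e * p'.2) by rewrite mulrA ee mul1r.
    by rewrite -h2 mulrDr mulrA ee mul1r /r; ring.
  have [hst hr] : step a b (z k) (z k.+1) /\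
      (if top_side (entry (c k)) then r < 0 else 0 < r).
    apply: (chord_step a0 b0) => //; rewrite -?tt //; apply/andP; split; lra.
  have sr : r = e * (-1) ^+ sigma * (len (c k) * kappa) by [].
  have lk : 0 < len (c k) * kappa by rewrite mulr_gt0.
  have pe : pent (c k) = pent_of (entry (c k)).
    move: hr; rewrite sr /e /pent_sign /pent_of -signr_addb.
    case: (pent (c k)); case: sigma; case: (top_side _) => //=;
      rewrite ?expr1 ?expr0; lra.
  split=> //; rewrite /z /= -tt -/p -/p' -pe -/e -ek hX.
  have -> : (-1) ^+ top_side (entry (c k)) * (r * a) / (kappa * a) = len (c k).
    rewrite -pent_sign_top -pe -/e sr.
    set g := (-1) ^+ sigma; have gg : g * g = 1 by rewrite /g -signr_addb addbb.
    have -> : e * g * (e * g * (len (c k) * kappa) * a) / (kappa * a) =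
      (e * e) * (g * g) * len (c k) by field; rewrite !gt_eqF.
    by rewrite ee gg !mul1r.
  by case: (c k).
have hz k : iter k F (z 0%N) = z k.
  by elim: k => //= k ->; apply: flow_of_step; case: (main k).
exists (z 0%N); split.
  by move=> k; rewrite hz; case: (main k) => /and4P[].
move=> k; rewrite /traj /chord_of hz; case: (main k) => hs ->.
by rewrite !pz (flow_of_step hs) pz.
Qed.
End Trajectories.

(** * Strips as bands *)

Section Strips.
Variable R : realType.
Local Notation state := (state R).
Variables (a b : R).
Hypotheses (a0 : 0 < a) (b0 : 0 < b).
Variables (theta kappa : R) (sigma : bool).
Hypothesis (k0 : 0 < kappa).
Hypothesis theta_dir : unit_vec theta = frame (scale ((-1) ^+ sigma * kappa) (a, b)).
Local Notation F := (flow a b).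
Local Notation chord_of := (chord_of a b kappa sigma).
Local Notation traj := (traj a b kappa sigma).
Implicit Types x y : state.

Lemma chord_of_inj x y : valid a b x -> valid a b y ->
  chord_of x = chord_of y -> x = y.
Proof.
move=> vx vy e; have hs : x.1 = y.1 by exact: (congr1 (@entry R) e).
move: (congr1 (@start R) e); rewrite /= hs => /frame_inj.
move=> /(scale_inj (pent_sign_neq0 _ _)) /(side_pt_inj (valid_label vy)) hp.
have [_ ->] := side_parP a0 b0 vx; have [_ ->] := side_parP a0 b0 vy.
by rewrite hs hp.
Qed.

Lemma frame_gt0 : 0 < cos (2 * pi / 5) :> R /\ 0 < sin (2 * pi / 5) :> R.
Proof.
have f1 := phi_gt1 R; have s0 := sin_pi5_gt0 R.
by rewrite cos_2pi5 sin_2pi5; split; [lra|rewrite mulr_gt0 //; lra].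
Qed.

Lemma side_pt_cross (l : nat) (t u : R) : l \in side_labels ->
  (-1) ^+ top_side l * (2 * (a * ((side_pt l u).2 - (side_pt l t).2) -
    b * ((side_pt l u).1 - (side_pt l t).1))) = - (2 * (u - t) * width a b l).
Proof.
rewrite !inE => /or4P[/eqP->|/eqP->|/eqP->|/orP[/eqP->|/eqP->]];
  rewrite /side_pt /corner /= ?expr0 ?expr1; ring.
Qed.

Lemma cross_chord_of x y : valid a b x -> valid a b y -> x.1 = y.1 ->
  cross (unit_vec theta) (start (chord_of y) - start (chord_of x)) =
  - (cos (2 * pi / 5) * sin (2 * pi / 5) * kappa) * (y.2 - x.2).
Proof.
move=> vx vy xy.
have [_ ex] := side_parP a0 b0 vx; have [_ ey] := side_parP a0 b0 vy.
have -> : y.2 - x.2 = 2 * (side_par a b y - side_par a b x) * width a b y.1.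
  by rewrite {1}ey {1}ex /= -xy; ring.
have := side_pt_cross (side_par a b x) (side_par a b y) (valid_label vx).
rewrite /chord_of -xy /start theta_dir.
move: (side_pt _ (side_par a b x)) (side_pt _ (side_par a b y)) => p q hpq.
set w := 2 * _ * _ in hpq *.
rewrite /cross /frame /scale /=.
set e := pent_sign _ _; set g := (-1) ^+ sigma.
set C := cos _; set S := sin _.
transitivity (C * S * kappa * (e * g * (2 * (a * (q.2 - p.2) - b * (q.1 - p.1))))).
  by ring.
by rewrite pent_sign_top hpq; ring.
Qed.

Lemma same_strip_traj x y : regular a b x -> regular a b y ->
  same_strip theta (traj x) (traj y) <-> parallel a b x y.
Proof.
move=> rx ry; split=> [[m [h H]]|[m H]]; exists m; first by move=> k; case: (H k).
exists (- (cos (2 * pi / 5) * sin (2 * pi / 5) * kappa) * (y.2 - (iter m F x).2)).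
move=> k; split; [by rewrite /= /pent_of H|by rewrite /= H|].
rewrite /traj cross_chord_of //; congr (_ * _).
rewrite [(m + k)%N]addnC iterD.
apply: same_itinerary_shift => //; first exact: regular_iter.
by move=> i; rewrite H addnC iterD.
Qed.

Lemma closed_traj x n : regular a b x ->
  closed_trajectory theta (traj x) n <-> periodic a b x n.
Proof.
move=> rx; split.
- move=> [_ n0 hn hm]; split=> //.
    by apply: chord_of_inj (rx n) (rx 0%N) _; apply: (hn 0%N).
  by move=> m /hm h e; apply: h; rewrite /traj e.
- move=> [_ n0 hn hm]; split=> //.
  + exact: regular_trajectory.
  + by move=> k; rewrite /traj iterD hn.
  + by move=> m hmn /(chord_of_inj (rx m) (rx 0%N)); apply: hm.
Qed.

Lemma two_strips_of_bands x1 n1 x2 n2 : two_bands a b x1 n1 x2 n2 ->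
  two_strips theta (traj x1) n1 (traj x2) n2.
Proof.
move=> [p1 p2 np hall]; have [r1 _ _ _] := p1; have [r2 _ _ _] := p2.
split; [exact/closed_traj|exact/closed_traj|by move/(same_strip_traj r1 r2)|].
move=> c /(trajectory_regular a0 b0 k0 theta_dir)[x [rx hx]].
have -> : c = traj x by apply/funext.
by case: (hall x rx) => h; [left|right]; apply/same_strip_traj.
Qed.

Lemma bands_of_two_strips c1 n1 c2 n2 : two_strips theta c1 n1 c2 n2 ->
  exists x1 x2, [/\ c1 = traj x1, c2 = traj x2 & two_bands a b x1 n1 x2 n2].
Proof.
move=> [h1 h2 np hall].
have tr := trajectory_regular a0 b0 k0 theta_dir.
have [x1 [r1 /funext e1]] : exists x, regular a b x /\ forall k, c1 k = traj x k.
  by apply: tr; case: h1.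
have [x2 [r2 /funext e2]] : exists x, regular a b x /\ forall k, c2 k = traj x k.
  by apply: tr; case: h2.
rewrite {}e1 {}e2 in h1 h2 np hall *.
exists x1, x2; split=> //; split.
- exact/closed_traj.
- exact/closed_traj.
- by move/(same_strip_traj r1 r2).
move=> x rx; have := hall _ (regular_trajectory a0 b0 k0 theta_dir rx).
by case=> /same_strip_traj h; [left|right]; apply: h.
Qed.

(** The first coordinate of the vector from the midpoint of the entry side to the
    crossing point; these vectors cancel along a closed orbit. *)
Definition offset x : R :=
  (-1) ^+ top_side x.1 * ((side_pt x.1 (side_par a b x)).1 - (side_pt x.1 (1 / 2)).1).

Lemma len_chord_of x : step a b x (F x) ->
  len (chord_of x) =
  ((holonomy R x.1 (F x).1).1 / 2 + offset (F x) - offset x) / (kappa * a).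
Proof.
move=> /and4P[_ _ /adjacentP ha _]; rewrite /chord_of /len /offset; congr (_ / _).
move: (F x) ha => y; move: (side_par a b x) (side_par a b y) x.1 y.1 => t u s s' [];
  by rewrite /side_pt /corner /= ?expr0 ?expr1; lra.
Qed.

Lemma orbit_length_traj x n : regular a b x -> iter n F x = x ->
  orbit_length (traj x) n = travel a b fst x n / (2 * (kappa * a)).
Proof.
move=> rx xn.
have h k : orbit_length (traj x) k =
    (travel a b fst x k / 2 + offset (iter k F x) - offset x) / (kappa * a).
  elim: k => [|k IH]; first by rewrite /orbit_length /travel !big_ord0 /=; ring.
  have -> : orbit_length (traj x) k.+1 = orbit_length (traj x) k + len (chord_of (iter k F x)).
    by rewrite /orbit_length big_ord_recr.
  rewrite IH travelS len_chord_of; last exact: regular_step.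
  rewrite !iterS; move: (iter k F x) => y; move: (travel _ _ _ _ _) (offset _) (offset _).
  by move=> T o o'; rewrite -/(fst _); ring.
by rewrite h xn; field; rewrite !gt_eqF.
Qed.

End Strips.

Lemma has_direction_frame (R : realType) (theta a b : R) : 0 < a -> 0 < b ->
  has_direction theta (dir_point (a, b)) ->
  exists (sigma : bool) (kappa : R), 0 < kappa /\
    unit_vec theta = frame (scale ((-1) ^+ sigma * kappa) (a, b)).
Proof.
move=> a0 b0 [s0]; have f1 := phi_gt1 R; have p0 := sin_pi5_gt0 R.
have ff := phi_sqr R.
have ab : 0 < a + b by rewrite addr_gt0.
rewrite /dir_point /= => h.
pose k := sin theta / (phi R * sin (pi / 5) * (a + b)).
have d0 : 0 < phi R * sin (pi / 5) * (a + b) by rewrite !mulr_gt0 //; lra.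
have k0 : k != 0 by rewrite mulf_neq0 // invr_neq0 // gt_eqF.
exists (k < 0), `|k|; split; first by rewrite normr_gt0.
have -> : (-1) ^+ (k < 0)%R * `|k| = k by rewrite -realEsign ?num_real.
have hc : cos theta = (1 - phi R / 2) * phi R * (a - b) * k.
  have -> : cos theta = - (- sin (pi / 5) * (cos theta / sin theta)) * sin theta / sin (pi / 5).
    by field; rewrite s0 gt_eqF.
  by rewrite -h /k; field; rewrite !gt_eqF //; lra.
rewrite /unit_vec /frame /scale /= cos_2pi5 sin_2pi5; congr pair.
  rewrite hc; have -> : (1 - phi R / 2) * phi R = (phi R - 1) / 2 by lra.
  by ring.
by rewrite /k; field; rewrite !gt_eqF //; lra.
Qed.

Lemma direction_exists (R : realType) (a b : R) : 0 < a -> 0 < b ->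
  exists theta kappa : R, [/\ 0 < kappa, has_direction theta (dir_point (a, b)) &
    unit_vec theta = frame (scale ((-1) ^+ false * kappa) (a, b))].
Proof.
move=> a0 b0; have f1 := phi_gt1 R; have p0 := sin_pi5_gt0 R.
have ff := phi_sqr R; have [C0 S0] := frame_gt0 R.
set C := cos _ in C0; set S := sin _ in S0.
have ab : 0 < a + b by rewrite addr_gt0.
set u := C * (a - b); set v := S * (a + b).
have v0 : 0 < v by rewrite mulr_gt0.
set N := Num.sqrt (u ^+ 2 + v ^+ 2).
have uv0 : 0 < u ^+ 2 + v ^+ 2 by rewrite ltr_wpDl ?sqr_ge0 // exprn_gt0.
have N0 : 0 < N by rewrite sqrtr_gt0.
have NN : N ^+ 2 = u ^+ 2 + v ^+ 2 by rewrite sqr_sqrtr // ltW.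
have uN : -1 <= u / N <= 1.
  rewrite -ler_norml normrM normfV (gtr0_norm N0) ler_pdivrMr // mul1r.
  by rewrite -sqrtr_sqr /N ler_wsqrtr // lerDl sqr_ge0.
exists (acos (u / N)), N^-1.
have hcos : cos (acos (u / N)) = N^-1 * u by rewrite acosK // mulrC.
have hsin : sin (acos (u / N)) = N^-1 * v.
  rewrite sin_acos //.
  have -> : 1 - (u / N) ^+ 2 = (v / N) ^+ 2.
    by rewrite !expr_div_n NN; field; rewrite gt_eqF.
  by rewrite sqrtr_sqr ger0_norm ?divr_ge0 ?ltW // mulrC.
split; first by rewrite invr_gt0.
- rewrite /has_direction hcos hsin; split; first by rewrite mulf_neq0 ?invr_neq0 ?gt_eqF.
  rewrite /dir_point /u /v /C /S cos_2pi5 sin_2pi5 /=.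
  have hf : (1 - phi R / 2) = (phi R - 1) / 2 / phi R.
    by apply: (mulIf (_ : phi R != 0)); [rewrite gt_eqF //; lra|rewrite divfK ?gt_eqF //; lra].
  by rewrite hf; field; rewrite !gt_eqF //; lra.
- rewrite /unit_vec hcos hsin /frame /scale /= -/C -/S expr0 mul1r.
  by congr pair; rewrite /u /v; ring.
Qed.

(** * The theorem *)

(** The old orbits are carried to orbits of the new direction, which are then
    realized by trajectories going upwards; the ratio of the lengths is that of the
    norms of the direction vectors, for both strips. *)
Lemma renormalized_strips (R : realType) (a b : R) (j : nat) (theta : R)
    (c1 : nat -> chord R) (n1 : nat) (c2 : nat -> chord R) (n2 : nat) :
  0 < a -> 0 < b -> (1 <= j <= 4)%N ->
  has_direction theta (dir_point (a, b)) -> two_strips theta c1 n1 c2 n2 ->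
  exists (theta' : R) (c1' : nat -> chord R) (m1 : nat)
      (c2' : nat -> chord R) (m2 : nat) (r : R),
    [/\ has_direction theta' (dir_point (renorm_dir j (a, b))),
        two_strips theta' c1' m1 c2' m2, 0 < r,
        orbit_length c1' m1 = r * orbit_length c1 n1 /\
        orbit_length c2' m2 = r * orbit_length c2 n2 &
        orbit_word c1' m1 = transform_word j (orbit_word c1 n1)].
Proof.
move=> a0 b0 hj hd hs.
have [sigma [kappa [k0 e]]] := has_direction_frame a0 b0 hd.
have [x1 [x2 [-> -> hb]]] := bands_of_two_strips a0 b0 k0 e hs.
have a'0 : 0 < renorm_fst j a b by apply: width_gt0.
have b'0 : 0 < renorm_snd j a b by apply: width_gt0.
have [theta' [kappa' [k'0 hd' e']]] := direction_exists a'0 b'0.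
have hb' := refine_two_bands a0 b0 hj hb.
have [[r1 n10 x1n _] [r2 n20 x2n _] _ _] := hb.
have [[r1' _ x1n' _] [r2' _ x2n' _] _ _] := hb'.
have len x n : regular a b x -> iter n (flow a b) x = x ->
    regular (renorm_fst j a b) (renorm_snd j a b) (renorm j x) ->
    iter (block_start j a b x n) (flow (renorm_fst j a b) (renorm_snd j a b))
      (renorm j x) = renorm j x ->
    orbit_length (traj (renorm_fst j a b) (renorm_snd j a b) kappa' false (renorm j x))
      (block_start j a b x n) =
    kappa / kappa' * orbit_length (traj a b kappa sigma x) n.
  move=> rx xn rx' xn'.
  rewrite (orbit_length_traj a'0 false k'0 rx' xn').
  rewrite (orbit_length_traj a0 sigma k0 rx xn).
  have t := travel_refine a0 b0 hj rx xn.
  have -> : travel a b fst x n = travel (renorm_fst j a b) (renorm_snd j a b) fst (renorm j x)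
      (block_start j a b x n) * a / renorm_fst j a b by rewrite t mulfK ?gt_eqF.
  by field; rewrite !gt_eqF.
exists theta', (traj (renorm_fst j a b) (renorm_snd j a b) kappa' false (renorm j x1)),
  (block_start j a b x1 n1), (traj (renorm_fst j a b) (renorm_snd j a b) kappa' false (renorm j x2)),
  (block_start j a b x2 n2), (kappa / kappa').
split=> //.
- exact: (two_strips_of_bands a'0 b'0 k'0 e').
- by rewrite divr_gt0.
- by split; apply: len.
- exact: itinerary_refine.
Qed.

(* The digits n_1, ..., n_(k-1) form the (possibly empty) sequence n, and nk is
   the last digit n_k. *)
Theorem theorem5 (R : realType) (n : seq nat) (nk : nat) (w : seq nat) (j : nat)
    (hn : all (fun d => d <= 3)%N n) (hnk : (1 <= nk <= 3)%N)
    (hj : (1 <= j <= 4)%N) :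
  (short_orbit (alpha R (rcons n nk)) w ->
   short_orbit (alpha R ((j - 1)%N :: rcons (map (fun d => 3 - d)%N n) (4 - nk)%N))
     (transform_word j w)) /\
  (long_orbit (alpha R (rcons n nk)) w ->
   long_orbit (alpha R ((j - 1)%N :: rcons (map (fun d => 3 - d)%N n) (4 - nk)%N))
     (transform_word j w)).
Proof.
have [a [b [a0 b0 -> /(_ j hj) ->]]] := alpha_directionP R hn hnk.
split=> -[theta [c1 [n1 [c2 [n2 [hd hs hlen hw]]]]]];
  have [theta' [c1' [m1 [c2' [m2 [r [hd' hs' r0 [l1 l2] hw']]]]]]] :=
    renormalized_strips a0 b0 hj hd hs;
  exists theta', c1', m1, c2', m2; split=> //.
- by rewrite l1 l2 ltr_pM2l.
- by rewrite hw'; apply: transform_word_cyclic.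
- by rewrite l1 l2 ltr_pM2l.
- by rewrite hw'; apply: transform_word_cyclic.
Qed.
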